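(* Let $n\in\mathbb{Z}$ with $|n|\geq1$, $\alpha>0$, $R>0$, and let $Q_0>0$. Consider the $n$-vortex equation $$(ru_r)_r-\frac{n^2}{r}u+\frac{2ru^3}{1+\alpha u^2}-2\kappa ru=0\ \text{ on }(0,R),\qquad u(0)=0,\quad u(R)=0,$$ for an unknown function $u$ and unknown constant $\kappa\in\mathbb{R}$, subject to the prescribed energy flux $Q(u)=Q_0$ and the finite-energy condition $\mathcal{E}(u)<\infty$. (i) There exists a solution pair $(u,\kappa)$ of this problem satisfying $u(r)>0$ for all $r\in(0,R)$. (ii) If $n^2+2r^2\kappa>0$ for all $r\in[0,R]$, then there exists no nontrivial finite-energy solution $u$ of the $n$-vortex equation with this $\kappa$ satisfying $Q(u)=Q_0\leq 1/4$.
   Context: The energy flux is $Q(u)=2\pi\int_0^R ru^2\,dr$ and the energy is $\mathcal{E}(u)=\frac12\int_0^R\left\{ru_r^2+\frac1r u^2+r\ln(1+\alpha u^2)\right\}dr$, for real-valued $u$ on $[0,R]$ (absolutely continuous, $u_r=du/dr$). *)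

(* Defs.v *)
From HB Require Import structures.
From mathcomp Require Import all_boot all_order all_algebra.
From mathcomp Require Import all_classical all_reals all_analysis.
Set Implicit Arguments. Unset Strict Implicit. Unset Printing Implicit Defensive.
Import Order.TTheory GRing.Theory Num.Theory.
Import numFieldNormedType.Exports.
Local Open Scope classical_set_scope.
Local Open Scope ring_scope.

Section Vortex.
Variable R : realType.

Definition flux (Rad : R) (u : R -> R) : \bar R :=
  ((2 * pi)%:E * \int[@lebesgue_measure R]_(r in `[0%R, Rad]) (r * u r ^+ 2)%:E)%E.

Definition energy (alpha Rad : R) (u : R -> R) : \bar R :=
  (\int[@lebesgue_measure R]_(r in `]0%R, Rad[)
     ((r * (derive1 u r) ^+ 2 + (u r) ^+ 2 / r + r * ln (1 + alpha * (u r) ^+ 2)) / 2)%:E)%E.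

Definition vortex_solution (n : int) (alpha Rad kappa : R) (u : R -> R) : Prop :=
  {within `[0%R, Rad], continuous u} /\
  (forall r, 0 < r < Rad ->
     derivable u r 1 /\ derivable (derive1 u) r 1 /\
     derive1 (fun s => s * derive1 u s) r - (n%:~R) ^+ 2 / r * u r
       + 2 * r * (u r) ^+ 3 / (1 + alpha * (u r) ^+ 2)
       - 2 * kappa * r * u r = 0) /\
  u 0 = 0 /\ u Rad = 0.

End Vortex.

(* Main.v *)
Require Import Defs.
From HB Require Import structures.
From mathcomp Require Import all_boot all_order all_algebra.
From mathcomp Require Import all_classical all_reals all_analysis.
From mathcomp Require Import ring lra.
Import Order.TTheory GRing.Theory Num.Theory.
Import numFieldNormedType.Exports.
Local Open Scope classical_set_scope.
Local Open Scope ring_scope.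

(* (i) Shooting. With [m = |n|], [lam = - 2 kappa] and [u = r^m v], the equation
   becomes [(r^(2m+1) v')' + r^(2m+1) (2 u^2 / (1 + alpha u^2) + lam) v = 0],
   which has a unique solution with [v 0 = a], [v' 0 = 0], depending continuously
   on [(lam, a)]. On a large rectangle of parameters the function
   [F = min_[0, Rad] v] is positive for [lam <= - 2 / alpha] and nonpositive for
   [lam] large, while the flux of [u] is below [Q0] for [a] small and above it
   for [a] large; the two-dimensional intermediate value theorem of
   Poincare-Miranda gives [(lam, a)] with [F = 0] and flux [Q0]. A nonnegative
   solution cannot touch [0] before [Rad], so [v > 0] on [0, Rad[ and [v Rad = 0].

   (ii) Multiplying the equation by [u] and integrating gives
   [int r u'^2 < int 2 r u^4], whereas the radial Ladyzhenskaya inequality gives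
   [int r u^4 <= 4 (int r u^2) (int r u'^2)]; these are incompatible when
   [int r u^2 <= 1 / 16], which follows from [Q0 <= 1 / 4] since [pi >= 2]. *)

(** * Calculus on the real line *)

(** Two constraints, the zero at [Rad] and the flux, have to be met at once; hence two shooting
    parameters and a planar intermediate value theorem. The minimum of [v] replaces [v Rad] because
    its vanishing also encodes the sign of [v], and it stays Lipschitz in the parameters. The factor
    [r^m] absorbs the singular term [n^2 u / r]: what remains is a radial Laplacian in dimension
    [2m + 2], regular at the center. Saturation makes the source globally Lipschitz in [v],
    uniformly in [r], so solutions are global and every bound is explicit on the parameter
    rectangle.

    In (ii) [u'] is available only on the open interval. The integration is therefore done on an
    inner interval [[a, b]] whose ends are points where [u u'] has a favourable sign. The remaining
    boundary error [b u(b)^2] is made small compared with an increment secured beforehand around a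
    point where [u] does not vanish; the slack in the numerical constants absorbs it. *)

Section calculus.
Context {R : realType}.
Implicit Types (f g : R -> R) (x y : R).

(* Unlike [is_derive], this is not a type class, so that [apply:] does not
   trigger instance resolution on the derivatives of subterms. *)
Definition has_deriv f x (df : R) := is_derive x (1 : R) f df.

Lemma has_deriv_eq f x df df' : has_deriv f x df -> df = df' -> has_deriv f x df'.
Proof. by move=> ? <-. Qed.

Lemma has_deriv_add f g x df dg : has_deriv f x df -> has_deriv g x dg ->
  has_deriv (fun t => f t + g t) x (df + dg).
Proof. by move=> hf hg; exact: is_deriveD. Qed.

Lemma has_deriv_opp f x df : has_deriv f x df ->
  has_deriv (fun t => - f t) x (- df).
Proof. by move=> hf; exact: is_deriveN. Qed.

Lemma has_deriv_mul f g x df dg : has_deriv f x df -> has_deriv g x dg ->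
  has_deriv (fun t => f t * g t) x (df * g x + f x * dg).
Proof.
move=> hf hg; apply: (@has_deriv_eq _ _ (f x *: dg + g x *: df)).
  exact: is_deriveM.
by rewrite /GRing.scale/=; ring.
Qed.

Lemma has_deriv_id x : has_deriv (fun t => t) x 1.
Proof. exact: is_derive_id. Qed.

Lemma has_deriv_cst (c x : R) : has_deriv (fun=> c) x 0.
Proof. exact: is_derive_cst. Qed.

Lemma has_deriv_exp f n x df : has_deriv f x df ->
  has_deriv (fun t => f t ^+ n) x (n%:R * f x ^+ n.-1 * df).
Proof.
move=> hf; elim: n => [|n IH].
  by rewrite !mul0r (_ : (fun _ => _) = cst 1)//; exact: has_deriv_cst.
rewrite (_ : (fun _ => _) = (fun t => f t * f t ^+ n)); last first.
  by apply/funext => t; rewrite exprS.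
apply: (has_deriv_eq _ _ _ _ (has_deriv_mul _ _ _ _ _ hf IH)).
case: n {IH} => [|n] /=; first by rewrite !expr0; ring.
by rewrite -natr1 [f x ^+ n.+1]exprS; ring.
Qed.

Lemma has_deriv_inv f x df : f x != 0 -> has_deriv f x df ->
  has_deriv (fun t => (f t)^-1) x (- df / f x ^+ 2).
Proof.
move=> fx0 [df1 df2]; apply: DeriveDef; first exact: derivableV.
by rewrite deriveV// df2 /GRing.scale/=; field.
Qed.

Lemma has_deriv_expR f x df : has_deriv f x df ->
  has_deriv (fun t => expR (f t)) x (df * expR (f x)).
Proof.
move=> hf; rewrite mulrC.
exact: (@is_derive1_comp _ expR f x _ _ (is_derive_expR _) hf).
Qed.

Lemma has_deriv_continuous f x df : has_deriv f x df -> {for x, continuous f}.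
Proof.
by move=> [h _]; apply: differentiable_continuous; apply/derivable1_diffP.
Qed.

Lemma near_has_deriv f g x df : {near x, f =1 g} ->
  has_deriv f x df -> has_deriv g x df.
Proof.
move=> fg [h1 h2]; apply: near_eq_is_derive fg (DeriveDef h1 h2).
Qed.

Lemma continuous_addf f g x : {for x, continuous f} -> {for x, continuous g} ->
  {for x, continuous (fun t => f t + g t)}.
Proof. by move=> hf hg; exact: continuousD. Qed.
Lemma continuous_oppf f x : {for x, continuous f} ->
  {for x, continuous (fun t => - f t)}.
Proof. by move=> hf; exact: continuousN. Qed.
Lemma continuous_mulf f g x : {for x, continuous f} -> {for x, continuous g} ->
  {for x, continuous (fun t => f t * g t)}.
Proof. by move=> hf hg; exact: continuousM. Qed.
Lemma continuous_expf f n x : {for x, continuous f} ->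
  {for x, continuous (fun t => f t ^+ n)}.
Proof.
move=> hf; elim: n => [|n IH].
  by rewrite (_ : (fun _ => _) = cst 1)//; exact: cst_continuous.
rewrite (_ : (fun _ => _) = (fun t => f t * f t ^+ n)).
  exact: continuous_mulf.
by apply/funext => t; rewrite exprS.
Qed.
Lemma continuous_invf f x : f x != 0 -> {for x, continuous f} ->
  {for x, continuous (fun t => (f t)^-1)}.
Proof. by move=> h0 hf; exact: cvgV. Qed.
Lemma continuous_idf x : {for x, continuous (fun t : R => t)}.
Proof. exact: cvg_id. Qed.
Lemma continuous_cstf (c : R) x : {for x, continuous (fun t : R => c)}.
Proof. exact: cst_continuous. Qed.
Lemma continuous_normf f x : {for x, continuous f} ->
  {for x, continuous (fun t => `|f t|)}.
Proof. by move=> hf; apply: (continuous_comp hf); exact: norm_continuous. Qed.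
Lemma continuous_lnf f x : 0 < f x -> {for x, continuous f} ->
  {for x, continuous (fun t => ln (f t))}.
Proof. by move=> h0 hf; apply: (continuous_comp hf); exact: continuous_ln. Qed.

End calculus.

(* The differentiation and continuity tactics dispatch on the syntax of the
   function: unification up to conversion may diverge on ring operations. *)
Ltac der := try eassumption;
  lazymatch goal with
  | |- has_deriv (fun t => t) _ _ => apply: has_deriv_id
  | |- has_deriv (fun _ => ?c) _ _ => apply: (has_deriv_cst c)
  | |- has_deriv (fun t => @?f t + @?g t) _ _ => apply: (has_deriv_add f g); der
  | |- has_deriv (fun t => - @?f t) _ _ => apply: (has_deriv_opp f); der
  | |- has_deriv (fun t => @?f t * @?g t) _ _ => apply: (has_deriv_mul f g); der
  | |- has_deriv (fun t => @?f t ^+ ?n) _ _ => apply: (has_deriv_exp f n); der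
  | |- has_deriv (fun t => (@?f t)^-1) _ _ =>
      apply: (has_deriv_inv f); [idtac | der]
  | |- has_deriv (fun t => expR (@?f t)) _ _ => apply: (has_deriv_expR f); der
  | _ => idtac
  end.

Ltac cont_at := try assumption;
  lazymatch goal with
  | |- continuous_at ?x (fun t => t) => apply: continuous_idf
  | |- continuous_at ?x (fun _ => ?c) => apply: (continuous_cstf c)
  | |- continuous_at ?x (fun t => @?f t + @?g t) =>
      refine (continuous_addf f g x _ _); fold_cont
  | |- continuous_at ?x (fun t => - @?f t) =>
      refine (continuous_oppf f x _); fold_cont
  | |- continuous_at ?x (fun t => @?f t * @?g t) =>
      refine (continuous_mulf f g x _ _); fold_cont
  | |- continuous_at ?x (fun t => @?f t ^+ ?n) =>
      refine (continuous_expf f n x _); fold_cont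
  | |- continuous_at ?x (fun t => (@?f t)^-1) =>
      refine (continuous_invf f x _ _); [idtac | fold_cont]
  | |- continuous_at ?x (fun t => `|@?f t|) =>
      refine (continuous_normf f x _); fold_cont
  | |- continuous_at ?x (fun t => ln (@?f t)) =>
      refine (continuous_lnf f x _ _); [idtac | fold_cont]
  | _ => idtac
  end
with fold_cont := lazymatch goal with
  | |- {for ?x, continuous ?f} => change (continuous_at x f)
  | _ => idtac
  end; cont_at.
Ltac cont := fold_cont.

(** * Mean value inequalities, extreme values and primitives *)

Section calculus2.
Context {R : realType}.
Implicit Types (f g : R -> R) (x y : R).

Lemma in_oo (a b x : R) : x \in `]a, b[%R = (a < x < b).
Proof. by rewrite in_itv. Qed.
Lemma in_cc (a b x : R) : x \in `[a, b]%R = (a <= x <= b).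
Proof. by rewrite in_itv. Qed.

Lemma continuous_within f (A : set R) :
  (forall x, A x -> {for x, continuous f}) -> {within A, continuous f}.
Proof.
move=> h; apply: continuous_in_subspaceT => x; rewrite inE; exact: h.
Qed.

Lemma mean_value f df (a b : R) : a < b ->
  (forall x, a < x < b -> has_deriv f x (df x)) ->
  (forall x, a <= x <= b -> {for x, continuous f}) ->
  exists2 c, a < c < b & f b - f a = df c * (b - a).
Proof.
move=> ab hd hc.
have hd' x : x \in `]a, b[%R -> has_deriv f x (df x) by rewrite in_oo; exact: hd.
have [|c cab e] := MVT ab hd'.
  by apply: continuous_within => x /=; rewrite in_cc; exact: hc.
by exists c; rewrite -?in_oo.
Qed.

Lemma derive_ge0_le f df (a b : R) : a <= b ->
  (forall x, a < x < b -> has_deriv f x (df x)) ->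
  (forall x, a <= x <= b -> {for x, continuous f}) ->
  (forall x, a < x < b -> 0 <= df x) -> f a <= f b.
Proof.
rewrite le_eqVlt => /orP[/eqP-> //|ab] hd hc h0.
have [c /h0 cab e] := mean_value _ _ _ _ ab hd hc.
by rewrite -subr_ge0 e mulr_ge0// subr_ge0 ltW.
Qed.

(** Plays the role of the norm inequality for integrals: later integral estimates are comparisons
    with an explicit antiderivative [g]. *)
Lemma derive_norm_le f g df dg (a b : R) : a <= b ->
  (forall x, a < x < b -> has_deriv f x (df x)) ->
  (forall x, a < x < b -> has_deriv g x (dg x)) ->
  (forall x, a <= x <= b -> {for x, continuous f}) ->
  (forall x, a <= x <= b -> {for x, continuous g}) ->
  (forall x, a < x < b -> `|df x| <= dg x) -> `|f b - f a| <= g b - g a.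
Proof.
move=> ab hf hg cf cg h.
rewrite ler_norml; apply/andP; split.
  rewrite -subr_ge0; have : f a + g a <= f b + g b; last lra.
  apply: (derive_ge0_le (fun t => f t + g t) (fun t => df t + dg t)) => //.
  - by move=> x xab; move: (hf x xab) (hg x xab) => ? ?; der.
  - by move=> x xab; move: (cf x xab) (cg x xab) => ? ?; cont.
  - by move=> x /h; rewrite ler_norml => /andP[? ?]; lra.
have : g a + - f a <= g b + - f b; last lra.
apply: (derive_ge0_le (fun t => g t + - f t) (fun t => dg t + - df t)) => //.
- by move=> x xab; move: (hf x xab) (hg x xab) => ? ?; der.
- by move=> x xab; move: (cf x xab) (cg x xab) => ? ?; cont.
- by move=> x /h; rewrite ler_norml => /andP[? ?]; lra.
Qed.

Lemma max_attained f (a b : R) : a <= b ->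
  (forall x, a <= x <= b -> {for x, continuous f}) ->
  exists2 c, a <= c <= b & forall t, a <= t <= b -> f t <= f c.
Proof.
move=> ab cf; have [|c cab h] := @EVT_max R f a b ab _.
  by apply: continuous_within => x /=; rewrite in_cc; exact: cf.
by exists c; rewrite -?in_cc// => t; rewrite -in_cc; exact: h.
Qed.

Lemma min_attained f (a b : R) : a <= b ->
  (forall x, a <= x <= b -> {for x, continuous f}) ->
  exists2 c, a <= c <= b & forall t, a <= t <= b -> f c <= f t.
Proof.
move=> ab cf; have [|c cab h] := @EVT_min R f a b ab _.
  by apply: continuous_within => x /=; rewrite in_cc; exact: cf.
by exists c; rewrite -?in_cc// => t; rewrite -in_cc; exact: h.
Qed.

Lemma zero_attained f (a b : R) : a <= b ->
  (forall x, a <= x <= b -> {for x, continuous f}) ->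
  0 <= f a -> f b <= 0 -> exists2 c, a <= c <= b & f c = 0.
Proof.
move=> ab cf fa fb.
have [||c cab h] := @IVT R f a b 0 ab _ _.
- by apply: continuous_within => x /=; rewrite in_cc; exact: cf.
- by rewrite ge_min le_max fa fb orbT.
by exists c; rewrite -?in_cc.
Qed.

(* The base point [-1] makes the primitive two-sided differentiable at [0]. *)
Definition primitive f (x : R) : R :=
  \int[lebesgue_measure]_(t in `[-1, x]) f t
  - \int[lebesgue_measure]_(t in `[-1, 0]) f t.

Lemma primitive0 f : primitive f 0 = 0.
Proof. by rewrite /primitive subrr. Qed.

Lemma has_deriv_primitive f x : continuous f -> -1 < x ->
  has_deriv (primitive f) x (f x).
Proof.
move=> cf x1.
have fi : lebesgue_measure.-integrable `[-1, x + 1] (EFin \o f).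
  apply: continuous_compact_integrable; first exact: segment_compact.
  by apply: continuous_within => y _; exact: cf.
have xu : x < x + 1 by rewrite ltrDl.
have [h1 h2] := continuous_FTC1_closed xu fi x1 (cf x).
pose c : R := - \int[lebesgue_measure]_(t in `[-1, 0]) f t.
have h3 : has_deriv (fun y : R => \int[lebesgue_measure]_(t in `[-1, y]) f t) x (f x).
  by apply: DeriveDef; [exact: h1|rewrite -h2 derive1E].
by rewrite -[f x]addr0; exact: (has_deriv_add _ _ _ _ _ h3 (has_deriv_cst c x)).
Qed.

Lemma continuous_primitive f x : continuous f -> -1 < x ->
  {for x, continuous (primitive f)}.
Proof.
by move=> cf x1; apply: has_deriv_continuous; exact: has_deriv_primitive.
Qed.

Lemma integral_primitive f (b : R) : continuous f -> 0 < b ->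
  (\int[lebesgue_measure]_(t in `[0%R, b]) (f t)%:E = (primitive f b)%:E)%E.
Proof.
move=> cf b0.
rewrite (@continuous_FTC2 R f (primitive f) 0 b b0).
- by rewrite primitive0 sube0.
- by apply: continuous_within => y _; exact: cf.
- split.
  + move=> x; rewrite in_oo => /andP[x0 _].
    by have [] := has_deriv_primitive f x cf (lt_trans (ltrN10 _) x0).
  + by apply: cvg_at_right_filter; apply: continuous_primitive => //; exact: ltrN10.
  + apply: cvg_at_left_filter; apply: continuous_primitive => //.
    by rewrite (lt_trans (ltrN10 _)).
- move=> x; rewrite in_oo => /andP[x0 _]; rewrite derive1E.
  by have [_ ->] := has_deriv_primitive f x cf (lt_trans (ltrN10 _) x0).
Qed.

End calculus2.

(** * Nonexistence for small flux *)

(** Here [X] is [th * m + d / th] with [th = 4 sqrt d], the optimal weight when [m = 1/16]. Then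
    [X <= sqrt d / 2], and with [e <= sqrt d / 4] the last right-hand side is at most
    [(1/16 + 1/4 + 1/2) d = 13/16 d], less than [d]. *)
Lemma flux_gap {R : realType} (m d e X : R) : 0 < d -> 0 <= m -> m <= 1 / 16 ->
  X = 4 * Num.sqrt d * m + d / (4 * Num.sqrt d) ->
  0 <= e -> 4 * e <= Num.sqrt d -> d <= e ^+ 2 + 2 * (e + X) * X -> False.
Proof.
move=> d0; have s0 : 0 < Num.sqrt d by rewrite sqrtr_gt0.
have := sqr_sqrtr (ltW d0); set s := Num.sqrt d in s0 *; clearbody s => <-.
move=> m0 m1 -> e0 es.
have -> : s ^+ 2 / (4 * s) = s / 4 by field; rewrite gt_eqF.
have : 4 * s * m <= 4 * s * (1 / 16) by rewrite ler_pM2l// mulr_gt0.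
have : 0 <= 4 * s * m by rewrite !mulr_ge0// ltW.
move: (4 * s * m) => y y0 y1 h.
have h1 : e * e <= (s / 4) * (s / 4) by apply: ler_pM => //; lra.
have h2 : (e + (y + s / 4)) * (y + s / 4) <= (s / 4 + s / 2) * (s / 2).
  by apply: ler_pM; lra.
have h3 : 0 < s * s by rewrite mulr_gt0.
move: h h1 h2 h3; clear; lra.
Qed.

Section nonexistence.
Context {R : realType}.
Implicit Types r th a b S e x : R.
Variables (u du : R -> R) (alpha Rad kappa c : R).
Hypotheses (alpha0 : 0 < alpha) (Rad0 : 0 < Rad) (cu : continuous u).
Hypothesis u0 : u 0 = 0.
Hypothesis uR : u Rad = 0.
Hypothesis du_ : forall r : R, 0 < r < Rad -> has_deriv u r (du r).
Hypothesis eqn : forall r : R, 0 < r < Rad -> has_deriv (fun s : R => s * du s) r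
  (c / r * u r - 2 * r * u r ^+ 3 / (1 + alpha * u r ^+ 2) + 2 * kappa * r * u r).
Hypothesis cpos : forall r : R, 0 < r < Rad -> 0 < c + 2 * r ^+ 2 * kappa.

Let mass := primitive (fun r : R => r * u r ^+ 2).
Let nl r := 2 * r * u r ^+ 4 / (1 + alpha * u r ^+ 2).
(** The equation multiplied by [u], in integrated form: [D' = dD], where [dD] dominates [r u'^2].
    Increments of [D] thus stand for the gradient energy, without any integral of [u'^2] being
    formed. *)
Let D r := r * du r * u r + primitive nl r.
Let dD r := r * du r ^+ 2 + (c + 2 * r ^+ 2 * kappa) * u r ^+ 2 / r.

Lemma den_gt0 r : 0 < 1 + alpha * u r ^+ 2.
Proof.
have : 0 <= alpha * u r ^+ 2 by rewrite mulr_ge0 ?sqr_ge0// ltW.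
lra.
Qed.

Let cmass : continuous (fun r : R => r * u r ^+ 2).
Proof. by move=> x; have := cu x => ?; cont. Qed.

Let cnl : continuous nl.
Proof.
by move=> x; have := cu x => ?; rewrite /nl; cont; rewrite gt_eqF ?den_gt0.
Qed.

Let dmass r : 0 <= r -> has_deriv mass r (r * u r ^+ 2).
Proof.
by move=> r0; apply: has_deriv_primitive => //; rewrite (lt_le_trans (ltrN10 _)).
Qed.

Let D_derive r : 0 < r < Rad -> has_deriv D r (dD r).
Proof.
move=> /[dup] /andP[r0 _] rR; have := eqn r rR; have := du_ r rR => h1 h2.
have h3 : has_deriv (primitive nl) r (nl r).
  by apply: has_deriv_primitive => //; rewrite (lt_trans (ltrN10 _)).
rewrite /D; apply: has_deriv_eq.
  apply: has_deriv_add; last exact: h3.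
  apply: (has_deriv_mul (fun s : R => s * du s)); [exact: h2 | exact: h1].
rewrite /nl /dD; field.
by rewrite gt_eqF//= gt_eqF// den_gt0.
Qed.

Let D_ge0 r : 0 < r < Rad -> r * du r ^+ 2 <= dD r.
Proof.
move=> /[dup] /andP[r0 _] /cpos h; rewrite /dD lerDl.
by apply: divr_ge0; [apply: mulr_ge0; [exact: ltW|exact: sqr_ge0]|exact: ltW].
Qed.

Let dD_ge0 r : 0 < r < Rad -> 0 <= dD r.
Proof.
move=> h; apply: le_trans (D_ge0 r h); rewrite mulr_ge0 ?sqr_ge0// ltW//.
by case/andP: h.
Qed.

Let D_le a b : 0 < a -> a <= b -> b < Rad -> D a <= D b.
Proof.
move=> a0 ab bR; apply: (derive_ge0_le D dD) => // x /andP[ax xb].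
- by apply: D_derive; lra.
- by apply: has_deriv_continuous; apply: D_derive; lra.
- by apply: dD_ge0; lra.
Qed.

(* [AM-GM]: [2 |u u'| <= th u^2 + u'^2 / th]. *)
Let amgm th r : 0 < th -> 0 < r < Rad ->
  2 * r * `|u r * du r| <= th * (r * u r ^+ 2) + dD r / th.
Proof.
move=> th0 rR; have r0 : 0 < r by case/andP: rR.
apply: (@le_trans _ _ (th * (r * u r ^+ 2) + r * du r ^+ 2 / th)); last first.
  by rewrite lerD2l ler_pM2r ?invr_gt0// D_ge0.
rewrite normrM -subr_ge0 -(real_normK (num_real (u r))).
rewrite -(real_normK (num_real (du r))).
set p := `|u r|; set q := `|du r|.
have -> : th * (r * p ^+ 2) + r * q ^+ 2 / th - 2 * r * (p * q)
   = r / th * (th * p - q) ^+ 2 by field; rewrite gt_eqF.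
by rewrite mulr_ge0 ?sqr_ge0// divr_ge0 ?ltW.
Qed.

Let X th a b := th * (mass b - mass a) + (D b - D a) / th.

Let mass_le a b : 0 <= a -> a <= b -> mass a <= mass b.
Proof.
move=> a0 ab; apply: (derive_ge0_le mass (fun r : R => r * u r ^+ 2)) => //.
- by move=> x /andP[ax xb]; apply: dmass; lra.
- by move=> x /andP[ax xb]; apply: has_deriv_continuous; apply: dmass; lra.
- by move=> x /andP[ax xb]; rewrite mulr_ge0 ?sqr_ge0//; lra.
Qed.

(** By [amgm], the derivative [u^2 + 2 s u u'] of [s u^2] is at least [- (th * mass + D / th)'], so
    the sum [s u^2 + th * mass + D / th] is nondecreasing. This is the pointwise half of the
    Ladyzhenskaya inequality. *)
Let rad_bound th a b r : 0 < th -> 0 < a -> a <= r <= b -> b < Rad ->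
  r * u r ^+ 2 <= b * u b ^+ 2 + X th a b.
Proof.
move=> th0 a0 /andP[ar rb] bR.
have r0 := lt_le_trans a0 ar.
have h : r * u r ^+ 2 + (th * mass r + D r / th)
      <= b * u b ^+ 2 + (th * mass b + D b / th).
  apply: (derive_ge0_le (fun s : R => s * u s ^+ 2 + (th * mass s + D s * th^-1))
     (fun s : R => (u s ^+ 2 + 2 * s * (u s * du s)) +
        (th * (s * u s ^+ 2) + dD s / th))) => // x /andP[rx xb].
  - have x0 : 0 <= x by lra.
    have xR : 0 < x < Rad by lra.
    have h1 := dmass x x0; have h2 := D_derive x xR; have h3 := du_ x xR.
    by apply: has_deriv_eq; [der | rewrite /=; ring].
  - have x0 : 0 <= x by lra.
    have xR : 0 < x < Rad by lra.
    have h1 := has_deriv_continuous _ _ _ (dmass x x0).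
    have h2 := has_deriv_continuous _ _ _ (D_derive x xR).
    by have h3 := cu x; cont.
  - have xR : 0 < x < Rad by lra.
    have := amgm th x th0 xR; have := sqr_ge0 (u x).
    have := ler_norm (- (u x * du x)); rewrite normrN.
    set p := u x * du x; set q := `|p| => pq s0.
    have : 2 * x * - p <= 2 * x * q by rewrite ler_pM2l//; lra.
    lra.
have h1 := mass_le a r (ltW a0) ar.
have h2 := D_le a r a0 ar (le_lt_trans rb bR).
have : th * mass a <= th * mass r by rewrite ler_pM2l.
have : D a / th <= D r / th by rewrite ler_pM2r// invr_gt0.
rewrite /X; lra.
Qed.

(** The integral half: [2 s u^4 = (s^2 u^4)' - 4 s^2 u^3 u'], and the last term is at most
    [2 S * (2 s |u u'|)], to which [amgm] applies. The boundary term at [a] has a good sign and is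
    dropped. *)
Let N_bound th a b S : 0 < th -> 0 < a -> a <= b -> b < Rad ->
  (forall r, a <= r <= b -> r * u r ^+ 2 <= S) ->
  primitive nl b - primitive nl a <= b ^+ 2 * u b ^+ 4 + 2 * S * X th a b.
Proof.
move=> th0 a0 ab bR hS.
have S0 : 0 <= S.
  have aab : a <= a <= b by lra.
  by apply: le_trans (hS a aab); rewrite mulr_ge0 ?sqr_ge0// ltW.
have : a ^+ 2 * u a ^+ 4 + (2 * S * (th * mass a + D a / th) - primitive nl a)
   <= b ^+ 2 * u b ^+ 4 + (2 * S * (th * mass b + D b / th) - primitive nl b).
  apply: (derive_ge0_le (fun s : R => s ^+ 2 * u s ^+ 4 + (2 * S * (th * mass s + D s * th^-1) - primitive nl s))
     (fun s : R => (2 * s * u s ^+ 4 + 4 * s ^+ 2 * u s ^+ 3 * du s) +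
       (2 * S * (th * (s * u s ^+ 2) + dD s / th) - nl s))) => // x /andP[ax xb].
  - have x0 : 0 <= x by lra.
    have xR : 0 < x < Rad by lra.
    have h1 := dmass x x0; have h2 := D_derive x xR; have h3 := du_ x xR.
    have h4 : has_deriv (primitive nl) x (nl x).
      by apply: has_deriv_primitive => //; rewrite (lt_le_trans (ltrN10 _)).
    by apply: has_deriv_eq; [der | rewrite /=; ring].
  - have x0 : 0 <= x by lra.
    have xR : 0 < x < Rad by lra.
    have h1 := has_deriv_continuous _ _ _ (dmass x x0).
    have h2 := has_deriv_continuous _ _ _ (D_derive x xR).
    have h4 : {for x, continuous (primitive nl)}.
      by apply: continuous_primitive => //; rewrite (lt_le_trans (ltrN10 _)).
    by have h3 := cu x; cont.
  - have xR : 0 < x < Rad by lra.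
    have x0 : 0 < x by lra.
    have nlx : nl x <= 2 * x * u x ^+ 4.
      rewrite /nl ler_pdivrMr ?den_gt0// ler_peMr//.
        by rewrite mulr_ge0 ?exprn_even_ge0//; lra.
      by rewrite lerDl mulr_ge0 ?sqr_ge0// ltW.
    have h1 := amgm th x th0 xR.
    have h2 : x * u x ^+ 2 <= S by apply: hS; lra.
    have h3 : 2 * S * (2 * x * `|u x * du x|) <= 2 * S * (th * (x * u x ^+ 2) + dD x / th).
      by rewrite ler_wpM2l// mulr_ge0.
    have h4 : x * u x ^+ 2 * (x * `|u x * du x|) <= S * (x * `|u x * du x|).
      by rewrite ler_wpM2r// mulr_ge0 ?normr_ge0// ltW.
    have h5 : x * u x ^+ 2 * (x * - (u x * du x)) <= x * u x ^+ 2 * (x * `|u x * du x|).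
      rewrite ler_wpM2l//; first by rewrite mulr_ge0 ?sqr_ge0// ltW.
      by rewrite ler_pM2l// -normrN ler_norm.
    have -> : 4 * x ^+ 2 * u x ^+ 3 * du x = - (4 * (x * u x ^+ 2 * (x * - (u x * du x)))) by ring.
    lra.
have : 0 <= a ^+ 2 * u a ^+ 4 by rewrite mulr_ge0 ?exprn_even_ge0.
rewrite /X.
have -> : 2 * S * (th * (mass b - mass a) + (D b - D a) / th) =
  2 * S * (th * mass b + D b / th) - 2 * S * (th * mass a + D a / th) by ring.
lra.
Qed.

Let sq_derive r : 0 < r < Rad -> has_deriv (fun s : R => u s ^+ 2) r (2 * (u r * du r)).
Proof.
by move=> /du_ h; apply: has_deriv_eq; [der | rewrite /=; ring].
Qed.

(** Since [u^2] vanishes at both ends, the mean value theorem yields points near [0] where it does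
    not decrease and, in [right_point], points near [Rad] where it does not increase. Between such
    points the boundary part of [D b - D a] is nonpositive. *)
Let left_point (a1 : R) : 0 < a1 < Rad -> exists2 a, 0 < a < a1 & 0 <= u a * du a.
Proof.
move=> /andP[a0 aR].
have [||a aa e] := mean_value (fun s : R => u s ^+ 2) (fun s : R => 2 * (u s * du s)) _ _ a0.
- by move=> x xa; apply: sq_derive; lra.
- by move=> x _; have := cu x => ?; cont.
exists a => //; move: e; rewrite u0 expr0n/= subr0 => e.
have : 0 <= 2 * (u a * du a) * a1 by rewrite subr0 in e; rewrite -e sqr_ge0.
by rewrite pmulr_lge0// pmulr_rge0.
Qed.

Let right_point (b1 e : R) : 0 < b1 < Rad -> 0 < e ->
  exists2 b, b1 < b < Rad & u b * du b <= 0 /\ b * u b ^+ 2 <= e.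
Proof.
move=> /andP[b0 bR] e0.
have cR : {for Rad, continuous (fun s : R => s * u s ^+ 2)} by have := cu Rad => ?; cont.
have : \forall x \near Rad, x * u x ^+ 2 < e.
  have : nbhs (Rad * u Rad ^+ 2) [set y : R | y < e].
    by apply: lt_nbhsl; rewrite uR expr0n/= mulr0.
  by move=> /cR.
rewrite -nbhs_nearE => /nbhs_ballP[d /= d0 hd].
pose b2 := Num.max b1 (Rad - d).
have b2R : b2 < Rad by rewrite gt_max; lra.
have b12 : b1 <= b2 by rewrite le_max lexx.
have b2d : Rad - d <= b2 by rewrite le_max lexx orbT.
have [||b bb h] := mean_value (fun s : R => u s ^+ 2) (fun s : R => 2 * (u s * du s)) _ _ b2R.
- by move=> x xa; apply: sq_derive; lra.
- by move=> x _; have := cu x => ?; cont.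
exists b; first lra.
split.
  have : 2 * (u b * du b) * (Rad - b2) <= 0.
    by rewrite -h uR expr0n/= sub0r oppr_le0 sqr_ge0.
  by rewrite pmulr_lle0 ?subr_gt0// pmulr_rle0.
apply/ltW; apply: hd; rewrite /ball/= gtr0_norm; lra.
Qed.

Lemma small_mass_trivial : mass Rad <= 1 / 16 -> forall r, 0 < r < Rad -> u r = 0.
Proof.
move=> hm r rR; apply/eqP/negPn/negP => ur0.
have [a1 a1_gt0 a1r] : exists2 a1, 0 < a1 & a1 < r by exists (r / 2); lra.
have [b2 rb2 b2R] : exists2 b2, r < b2 & b2 < Rad.
  by exists ((r + Rad) / 2); lra.
have dDr : 0 < dD r.
  apply: lt_le_trans (_ : 0 < (c + 2 * r ^+ 2 * kappa) * u r ^+ 2 / r) _.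
    rewrite divr_gt0//; last by case/andP: rR.
    by rewrite mulr_gt0 ?cpos// exprn_even_gt0.
  by rewrite /dD lerDr mulr_ge0 ?sqr_ge0//; lra.
(* Equal values would make the monotone [D] constant on [[a1, b2]], against [D' r = dD r > 0] at the
   inner point [r]. *)
have Dpos : 0 < D b2 - D a1.
  rewrite lt_neqAle subr_ge0 D_le// ?andbT; last lra.
  apply/negP => /eqP/esym/subr0_eq e.
  have Dc s : a1 <= s <= b2 -> D s = D a1.
    move=> /andP[s1 s2]; apply/eqP; rewrite eq_le.
    by rewrite -{1}e !D_le//; lra.
  have : has_deriv D r 0.
    apply: (near_has_deriv (cst (D a1))); last exact: has_deriv_cst.
    near=> s; rewrite /= Dc//; apply/andP; split; apply/ltW; near: s.
      exact: lt_nbhsr.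
    exact: lt_nbhsl.
  move=> [_ h]; have [_ h'] := D_derive r rR.
  by move: dDr; rewrite -h' h ltxx.
(* The tolerance given to [right_point] must be fixed before [b] is known; it comes from the inner
   increment, which [D b - D a] dominates. *)
pose s1 := Num.sqrt (D b2 - D a1).
have s10 : 0 < s1 / 4 by rewrite divr_gt0// sqrtr_gt0.
have a1R : 0 < a1 < Rad by rewrite a1_gt0 (lt_trans a1r)// (lt_trans rb2).
have b2R' : 0 < b2 < Rad by rewrite b2R (lt_trans a1_gt0)// (lt_trans a1r).
have [a /andP[a0 aa1] ua] := left_point a1 a1R.
have [b /andP[b2b bR] [ub be]] := right_point b2 (s1 / 4) b2R' s10.
have a1b2 : a1 <= b2 by rewrite ltW// (lt_trans a1r).
have ab : a <= b by rewrite (le_trans (ltW aa1))// (le_trans a1b2)// ltW.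
have Dab : D b2 - D a1 <= D b - D a.
  have [[_ a1R'] [b20 _]] := (andP a1R, andP b2R').
  by apply: lerB; [exact: D_le (ltW b2b) bR|exact: D_le (ltW aa1) a1R'].
have d0 : 0 < D b - D a by exact: lt_le_trans Dab.
have th0 : 0 < 4 * Num.sqrt (D b - D a) by rewrite mulr_gt0 ?sqrtr_gt0.
apply: (flux_gap (mass b - mass a) (D b - D a) (b * u b ^+ 2) (X (4 * Num.sqrt (D b - D a)) a b)) => //.
- by rewrite subr_ge0 mass_le// ltW.
- have : 0 <= mass a.
    by rewrite -[0](primitive0 (fun r => r * u r ^+ 2)); apply: mass_le => //; exact: ltW.
  have : mass b <= mass Rad.
    by apply: mass_le; [exact: (le_trans (ltW a0) ab)|exact: (ltW bR)].
  move: (mass a) (mass b) (mass Rad) hm => ma mb mR; lra.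
- by rewrite mulr_ge0 ?sqr_ge0// (le_trans (ltW a0)).
- have : Num.sqrt (D b2 - D a1) <= Num.sqrt (D b - D a) by rewrite ler_sqrt// ltW.
  by move: be; rewrite /s1; move: (Num.sqrt _) (Num.sqrt _) (b * _) => ? ? ?; lra.
have hD : D b - D a <= primitive nl b - primitive nl a.
  have : 0 <= a * (u a * du a) by rewrite mulr_ge0// ltW.
  have : b * (u b * du b) <= 0 by rewrite pmulr_rle0// (lt_le_trans a0).
  by rewrite /D; move: (primitive nl a) (primitive nl b) => na nb; lra.
apply: (le_trans hD); have -> : (b * u b ^+ 2) ^+ 2 = b ^+ 2 * u b ^+ 4 by ring.
apply: N_bound => // x xab; exact: rad_bound.
Unshelve. all: by end_near. Qed.

End nonexistence.

(** * The two-dimensional intermediate value theorem *)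

(* Counts, modulo 2, the edges where [p] holds at both ends and [q] changes:
   around a cell on which [p] or [q] is constant this parity vanishes, so the
   parity along vertical grid lines is propagated from the left side, where it
   is odd, to the right side, where it is even. *)
Lemma sign_change_cell (N : nat) (p q : nat -> nat -> bool) :
  (forall j, (j <= N)%N -> p 0%N j) -> (forall j, (j <= N)%N -> ~~ p N j) ->
  (forall i, (i <= N)%N -> ~~ q i 0%N) -> (forall i, (i <= N)%N -> q i N) ->
  exists i j, [/\ (i < N)%N, (j < N)%N,
    ~~ [&& p i j == p i.+1 j, p i j == p i j.+1 & p i j == p i.+1 j.+1] &
    ~~ [&& q i j == q i.+1 j, q i j == q i j.+1 & q i j == q i.+1 j.+1]].
Proof.
move=> left right bottom top; apply: contrapT => nex.
pose v i j := [&& p i j, p i j.+1 & q i j (+) q i j.+1].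
pose h i j := [&& p i j, p i.+1 j & q i j (+) q i.+1 j].
pose V i := fix V k := if k is k'.+1 then V k' (+) v i k' else false.
have cell i j : (i < N)%N -> (j < N)%N ->
    v i j (+) v i.+1 j = h i j (+) h i j.+1.
  move=> iN jN; have : ~ (~~ [&& p i j == p i.+1 j, p i j == p i j.+1 & p i j == p i.+1 j.+1] /\
    ~~ [&& q i j == q i.+1 j, q i j == q i j.+1 & q i j == q i.+1 j.+1]).
    by move=> [h1 h2]; apply: nex; exists i, j.
  rewrite /v /h; move: (p i j) (p i.+1 j) (p i j.+1) (p i.+1 j.+1)
    (q i j) (q i.+1 j) (q i j.+1) (q i.+1 j.+1).
  by move=> [] [] [] [] [] [] [] [] //= []; split.
(* Summing [cell] up a strip, each inner horizontal edge is counted twice and cancels. *)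
have strip i k : (i < N)%N -> (k <= N)%N ->
    V i k (+) V i.+1 k = h i 0%N (+) h i k.
  move=> iN; elim: k => [|k IH] kN /=; first by rewrite addbb.
  have := cell i k iN kN; move: (IH (ltnW kN)).
  case: (V i k) (V i.+1 k) (v i k) (v i.+1 k) (h i 0%N) (h i k) (h i k.+1).
    by move=> [] [] [] [] [] [].
  by move=> [] [] [] [] [] [].
have step i : (i < N)%N -> V i N = V i.+1 N.
  move=> iN; have := strip i N iN (leqnn N).
  rewrite /h (negbTE (bottom _ (ltnW iN))) (negbTE (bottom _ iN)).
  rewrite (top _ (ltnW iN)) (top _ iN) /= !andbF.
  by case: (V i N) (V i.+1 N) => [] [].
(* On the left side [p] always holds, so every change of [q] is counted and the parity
   telescopes. *)
have V0 k : (k <= N)%N -> V 0%N k = q 0%N 0%N (+) q 0%N k.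
  elim: k => [|k IH] kN /=; first by rewrite addbb.
  rewrite IH ?(ltnW kN)// /v !left// ?(ltnW kN)//=.
  by case: (q _ _) (q _ _) (q _ _) => [] [] [].
have VN k : (k <= N)%N -> V N k = false.
  elim: k => [//|k IH] kN /=.
  by rewrite IH ?(ltnW kN)// /v (negbTE (right _ (ltnW kN))).
have VE k : (k <= N)%N -> V k N = true.
  elim: k => [|k IH] kN; last by rewrite -step// IH// ltnW.
  by rewrite V0// (negbTE (bottom _ (leq0n _))) top.
by have := VE N (leqnn N); rewrite VN.
Qed.

Section poincare_miranda.
Context {R : realType}.

Lemma sign_change_small (f : nat -> nat -> R) (i j : nat) (e : R) :
  (forall i' j', (i <= i' <= i.+1)%N -> (j <= j' <= j.+1)%N ->
     `|f i j - f i' j'| <= e) ->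
  ~~ [&& (0 < f i j) == (0 < f i.+1 j), (0 < f i j) == (0 < f i j.+1) &
         (0 < f i j) == (0 < f i.+1 j.+1)] -> `|f i j| <= e.
Proof.
move=> h; have main x : `|f i j - x| <= e -> (0 < f i j) != (0 < x) -> `|f i j| <= e.
  rewrite !ler_norml => /andP[h1 h2].
  by case: (ltrP 0 (f i j)) => h3; case: (ltrP 0 x) => h4 //= _; apply/andP; split; lra.
by rewrite !negb_and => /or3P[]; apply: main; apply: h; rewrite ?leqnn ?leqnSn.
Qed.

(** A Lipschitz constant, rather than mere continuity, lets a single mesh size control the variation
    on every cell. *)
Definition lipschitz_rect (a0 a1 b0 b1 K : R) (F : R -> R -> R) :=
  forall x y x' y', a0 <= x <= a1 -> a0 <= x' <= a1 ->
    b0 <= y <= b1 -> b0 <= y' <= b1 ->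
    `|F x y - F x' y'| <= K * (`|x - x'| + `|y - y'|).

(** By compactness [H = |F| + |G|] attains its minimum. Were this positive, a fine grid would
    contain a cell on which both [F] and [G] change sign, hence a corner where both are smaller than
    half that minimum. *)
Lemma poincare_miranda (a0 a1 b0 b1 K : R) (F G : R -> R -> R) :
  a0 < a1 -> b0 < b1 -> 0 < K ->
  lipschitz_rect a0 a1 b0 b1 K F -> lipschitz_rect a0 a1 b0 b1 K G ->
  (forall y, b0 <= y <= b1 -> 0 < F a0 y) ->
  (forall y, b0 <= y <= b1 -> F a1 y <= 0) ->
  (forall x, a0 <= x <= a1 -> G x b0 <= 0) ->
  (forall x, a0 <= x <= a1 -> 0 < G x b1) ->
  exists x y, [/\ a0 <= x <= a1, b0 <= y <= b1, F x y = 0 & G x y = 0].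
Proof.
move=> a01 b01 K0 LF LG Fl Fr Gb Gt.
pose A := `[a0, a1] `*` `[b0, b1] : set (R * R).
pose H (z : R * R) := `|F z.1 z.2| + `|G z.1 z.2|.
have inA z : A z <-> a0 <= z.1 <= a1 /\ b0 <= z.2 <= b1.
  by rewrite /A /= !in_cc.
have HL z w : A z -> A w -> `|H z - H w| <= 2 * K * (`|z.1 - w.1| + `|z.2 - w.2|).
  move=> /inA[z1 z2] /inA[w1 w2].
  have := LF _ _ _ _ z1 w1 z2 w2; have := LG _ _ _ _ z1 w1 z2 w2.
  have := ler_dist_dist (F z.1 z.2) (F w.1 w.2).
  have := ler_dist_dist (G z.1 z.2) (G w.1 w.2).
  rewrite /H; set d := _ + `|z.2 - w.2| => h1 h2 h3 h4.
  have -> : `|F z.1 z.2| + `|G z.1 z.2| - (`|F w.1 w.2| + `|G w.1 w.2|) =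
    (`|F z.1 z.2| - `|F w.1 w.2|) + (`|G z.1 z.2| - `|G w.1 w.2|) by ring.
  apply: (le_trans (ler_normD _ _)).
  have -> : 2 * K * d = K * d + K * d by ring.
  by apply: lerD; [exact: (le_trans h2)|exact: (le_trans h1)].
have cA : compact A by apply: compact_setX; exact: segment_compact.
have A0 : A !=set0 by exists (a0, b0); apply/inA => /=; rewrite !lexx !ltW.
have cH : {within A, continuous H}.
  apply/subspace_continuousP => z Az; apply/cvgrPdist_lt => e e0.
  rewrite near_withinE; have r0 : 0 < e / (4 * K) by rewrite divr_gt0// mulr_gt0.
  apply/nbhs_ballP; exists (e / (4 * K)) => //= w [h1 h2] Aw.
  apply: (le_lt_trans (HL _ _ Az Aw)).
  have -> : e = 2 * K * (e / (4 * K) + e / (4 * K)) by field; rewrite gt_eqF.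
  by rewrite ltr_pM2l ?mulr_gt0// ltrD.
have [z0 /set_mem Az0 minH] := compact_EVT_min A0 cA cH.
have [H0|Hn0] := eqVneq (H z0) 0.
  move/inA: Az0 => [h1 h2]; exists z0.1, z0.2; split=> //; apply/eqP.
    by rewrite -normr_le0 -H0 /H lerDl.
  by rewrite -normr_le0 -H0 /H lerDr.
have Hpos : 0 < H z0 by rewrite lt_neqAle eq_sym Hn0 addr_ge0.
exfalso.
pose W := (a1 - a0) + (b1 - b0).
have W0 : 0 < W by rewrite addr_gt0// subr_gt0.
(* Over one cell each of [F] and [G] varies by at most [K * W / N]; this [N] makes twice that bound
   smaller than the minimum [H z0]. *)
pose N := (Num.truncn (2 * K * W / H z0)).+1.
have Nn0 : 0 < N%:R :> R by rewrite ltr0n.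
have NH : 2 * K * W / N%:R < H z0.
  rewrite ltr_pdivrMr// -ltr_pdivrMl// [X in X < _]mulrC.
  exact: truncnS_gt.
pose X i := a0 + (a1 - a0) * (i%:R / N%:R).
pose Y i := b0 + (b1 - b0) * (i%:R / N%:R).
have frac i : (i <= N)%N -> 0 <= (i%:R / N%:R : R) <= 1.
  by move=> iN; rewrite divr_ge0//= ler_pdivrMr// mul1r ler_nat.
have between (u v t : R) : u < v -> 0 <= t <= 1 -> u <= u + (v - u) * t <= v.
  move=> uv /andP[t0 t1]; rewrite lerDl mulr_ge0 ?subr_ge0 ?(ltW uv)//=.
  by rewrite -lerBrDl ler_piMr// subr_ge0 ltW.
have XA i : (i <= N)%N -> a0 <= X i <= a1 by move=> /frac; exact: between.
have YA i : (i <= N)%N -> b0 <= Y i <= b1 by move=> /frac; exact: between.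
have X0 : X 0%N = a0 by rewrite /X mul0r mulr0 addr0.
have Y0 : Y 0%N = b0 by rewrite /Y mul0r mulr0 addr0.
have XN : X N = a1 by rewrite /X divff ?gt_eqF// mulr1 addrC subrK.
have YN : Y N = b1 by rewrite /Y divff ?gt_eqF// mulr1 addrC subrK.
have fstep i i' : (i <= i' <= i.+1)%N -> `|i%:R / N%:R - i'%:R / N%:R : R| <= N%:R^-1.
  move=> /andP[h1 h2]; rewrite -mulrBl normrM [`|_^-1|]gtr0_norm ?invr_gt0//.
  rewrite -[leRHS]mul1r ler_pM2r ?invr_gt0// distrC -natrB// normr_nat lern1.
  by rewrite leq_subLR addn1.
have [||||i [j [iN jN pij qij]]] :=
    @sign_change_cell N (fun i j => 0 < F (X i) (Y j)) (fun i j => 0 < G (X i) (Y j)).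
- by move=> j jN; rewrite X0; apply: Fl; exact: YA.
- by move=> j jN; rewrite XN -leNgt; apply: Fr; exact: YA.
- by move=> i iN; rewrite Y0 -leNgt; apply: Gb; exact: XA.
- by move=> i iN; rewrite YN; apply: Gt; exact: XA.
have small (P : R -> R -> R) : lipschitz_rect a0 a1 b0 b1 K P ->
    forall i' j', (i <= i' <= i.+1)%N -> (j <= j' <= j.+1)%N ->
    `|P (X i) (Y j) - P (X i') (Y j')| <= K * (W / N%:R).
  move=> LP i' j' hi hj.
  have i'N : (i' <= N)%N by case/andP: hi => _ /leq_trans; apply.
  have j'N : (j' <= N)%N by case/andP: hj => _ /leq_trans; apply.
  apply: (le_trans (LP _ _ _ _ (XA _ (ltnW iN)) (XA _ i'N) (YA _ (ltnW jN)) (YA _ j'N))).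
  rewrite ler_pM2l// /W mulrDl; apply: lerD.
    have -> : X i - X i' = (a1 - a0) * (i%:R / N%:R - i'%:R / N%:R) by rewrite /X; ring.
    rewrite normrM gtr0_norm ?subr_gt0//.
    by rewrite ler_pM2l ?subr_gt0// fstep.
  have -> : Y j - Y j' = (b1 - b0) * (j%:R / N%:R - j'%:R / N%:R) by rewrite /Y; ring.
  rewrite normrM gtr0_norm ?subr_gt0//.
  by rewrite ler_pM2l ?subr_gt0// fstep.
have h1 := sign_change_small (fun i j => F (X i) (Y j)) i j _ (small F LF) pij.
have h2 := sign_change_small (fun i j => G (X i) (Y j)) i j _ (small G LG) qij.
have : H (X i, Y j) <= 2 * K * W / N%:R.
  have -> : 2 * K * W / N%:R = K * (W / N%:R) + K * (W / N%:R) by ring.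
  exact: lerD.
apply/negP; rewrite -ltNge; apply: (lt_le_trans NH); apply: minH.
by apply/mem_set/inA; split; [apply: XA; exact: ltnW|apply: YA; exact: ltnW].
Qed.

End poincare_miranda.

(** * The radial operator *)

Section radial_operator.
Context {R : realType}.
Variable k : nat.
Implicit Types (g : R -> R) (s t r C T mu : R).

Definition moment g := primitive (fun t => t ^+ k.+1 * g t).
(* At [s = 0] the quotient is [0 / 0 = 0], which is the continuous value. *)
Definition average g s := moment g s / s ^+ k.+1.
(* The solution of [(r^k.+1 v')' = r^k.+1 g], [v 0 = v' 0 = 0], extended to an
   even function of [r]. *)
Definition radial g r := primitive (fun s => average g `|s|) `|r|.

Lemma N1_lt s : 0 <= s -> -1 < s.
Proof. exact: lt_le_trans (ltrN10 _). Qed.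

Let cweight g : continuous g -> continuous (fun t => t ^+ k.+1 * g t).
Proof. by move=> cg x; have := cg x => ?; cont. Qed.

Lemma moment_deriv g s : continuous g -> 0 <= s ->
  has_deriv (moment g) s (s ^+ k.+1 * g s).
Proof.
by move=> cg s0; apply: has_deriv_primitive; [exact: cweight|exact: N1_lt].
Qed.

Lemma moment0 g : moment g 0 = 0. Proof. exact: primitive0. Qed.

Lemma average0 g : average g 0 = 0.
Proof. by rewrite /average moment0 mul0r. Qed.

Lemma radial0 g : radial g 0 = 0.
Proof. by rewrite /radial normr0 primitive0. Qed.

Lemma moment_diff_le g1 g2 (c dc : R -> R) s :
  continuous g1 -> continuous g2 -> 0 <= s ->
  (forall t, 0 <= t <= s -> has_deriv c t (dc t)) ->
  (forall t, 0 < t < s -> t ^+ k.+1 * `|g1 t - g2 t| <= dc t) -> c 0 = 0 ->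
  `|moment g1 s - moment g2 s| <= c s.
Proof.
move=> c1 c2 s0 hc hg c0.
have /= := derive_norm_le (fun t => moment g1 t + - moment g2 t) c
  (fun t => t ^+ k.+1 * g1 t + - (t ^+ k.+1 * g2 t)) dc 0 s s0.
rewrite !moment0 c0 !(oppr0, addr0); apply.
- move=> x /andP[/ltW x0 _].
  by have h1 := moment_deriv g1 x c1 x0; have h2 := moment_deriv g2 x c2 x0; der.
- by move=> x /andP[/ltW x0 /ltW xs]; apply: hc; rewrite x0.
- move=> x /andP[x0 _].
  have h1 := has_deriv_continuous _ _ _ (moment_deriv g1 x c1 x0).
  by have h2 := has_deriv_continuous _ _ _ (moment_deriv g2 x c2 x0); cont.
- by move=> x xs; apply: has_deriv_continuous; exact: hc.
- move=> x /[dup] xs /hg; rewrite -mulrBr normrM normrX gtr0_norm//.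
  by case/andP: xs.
Qed.

Lemma average_diff_le g1 g2 s c : 0 < s ->
  `|moment g1 s - moment g2 s| <= s ^+ k.+1 * c ->
  `|average g1 s - average g2 s| <= c.
Proof.
move=> s0; rewrite /average -mulrBl normrM normfV normrX (gtr0_norm s0).
by rewrite ler_pdivrMr ?exprn_gt0// mulrC.
Qed.

(** The comparison function [t^(k+1) C e^(mu t) / mu] has derivative [t^(k+1) C e^(mu t)] plus a
    nonnegative term coming from the weight. The singular weight thus costs nothing and one factor
    [1 / mu] is gained. *)
Lemma average_diff_le_exp g1 g2 C mu s :
  continuous g1 -> continuous g2 -> 0 < mu -> 0 <= s -> 0 <= C ->
  (forall t, 0 <= t <= s -> `|g1 t - g2 t| <= C * expR (mu * t)) ->
  `|average g1 s - average g2 s| <= C * expR (mu * s) / mu.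
Proof.
move=> c1 c2 mu0; rewrite le_eqVlt => /orP[/eqP<- C0 _|s0 C0 hg].
  by rewrite !average0 subrr normr0 divr_ge0 ?mulr_ge0 ?expR_ge0// ltW.
apply: average_diff_le => //.
apply: (moment_diff_le g1 g2 (fun t => t ^+ k.+1 * (C * expR (mu * t) / mu))
  (fun t => k.+1%:R * t ^+ k * (C * expR (mu * t) / mu) +
     t ^+ k.+1 * (C * expR (mu * t)))) => //.
- exact: ltW.
- move=> t _; apply: has_deriv_eq; first by der.
  by rewrite /=; field; rewrite gt_eqF.
- move=> t /andP[t0 ts].
  have ht : `|g1 t - g2 t| <= C * expR (mu * t) by apply: hg; rewrite !ltW.
  have h1 : t ^+ k.+1 * `|g1 t - g2 t| <= t ^+ k.+1 * (C * expR (mu * t)).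
    by rewrite ler_pM2l// exprn_gt0.
  apply: (le_trans h1); rewrite lerDr mulr_ge0//.
    by rewrite mulr_ge0// exprn_ge0// ltW.
  by rewrite divr_ge0 ?mulr_ge0 ?expR_ge0// ltW.
- by rewrite expr0n/= mul0r.
Qed.

Lemma moment_cst0 s : 0 <= s -> moment (fun=> 0) s = 0.
Proof.
move=> s0; have c0 : continuous (fun _ : R => 0 : R) by move=> x; cont.
have /= := derive_norm_le (moment (fun=> 0)) (fun=> 0) (fun=> 0) (fun=> 0) 0 s s0.
rewrite !moment0 !subr0 => h; apply/eqP; rewrite -normr_le0; apply: h.
- move=> x /andP[/ltW x0 _]; apply: has_deriv_eq; first exact: moment_deriv.
  by rewrite mulr0.
- by move=> x _; der.
- move=> x /andP[x0 _]; exact: has_deriv_continuous (moment_deriv _ _ c0 x0).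
- by move=> x _; cont.
- by move=> x _; rewrite normr0.
Qed.

Lemma average_cst0 s : 0 <= s -> average (fun=> 0) s = 0.
Proof. by move=> s0; rewrite /average moment_cst0// mul0r. Qed.

Lemma average_le_lin g C s : continuous g -> 0 <= s ->
  (forall t, 0 <= t <= s -> `|g t| <= C) -> `|average g s| <= C * s.
Proof.
move=> cg; rewrite le_eqVlt => /orP[/eqP<- _|s0 hg].
  by rewrite average0 normr0 mulr0.
have C0 : 0 <= C by rewrite (le_trans (normr_ge0 _) (hg 0 _))// lexx ltW.
rewrite -[average g s]subr0 -(average_cst0 s (ltW s0)).
apply: average_diff_le => //.
apply: (moment_diff_le g (fun=> 0) (fun t => t ^+ k.+1 * (C * t))
  (fun t => k.+1%:R * t ^+ k * (C * t) + t ^+ k.+1 * C)) => //.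
- by move=> x; cont.
- exact: ltW.
- by move=> t _; apply: has_deriv_eq; [der|rewrite /=; ring].
- move=> t /andP[t0 ts]; rewrite subr0.
  have h1 : t ^+ k.+1 * `|g t| <= t ^+ k.+1 * C.
    by rewrite ler_pM2l ?exprn_gt0// hg// !ltW.
  by apply: (le_trans h1); rewrite lerDr !mulr_ge0// ?exprn_ge0// ltW.
- by rewrite mulr0 mulr0.
Qed.

(** Away from [0] this is a quotient of continuous functions; at [0] the linear bound
    [average_le_lin] takes over. *)
Lemma continuous_average g : continuous g -> continuous (fun s => average g `|s|).
Proof.
move=> cg x; have [->|x0] := eqVneq x 0; last first.
  have h1 : {for x, continuous (fun s => moment g `|s|)}.
    have h : {for `|x|, continuous (moment g)}.
      exact: has_deriv_continuous (moment_deriv g _ cg (normr_ge0 x)).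
    by apply: (continuous_comp _ h); exact: norm_continuous.
  by rewrite /average; cont; rewrite expf_neq0// normr_eq0.
have [c _ hc] := max_attained (fun t => `|g t|) 0 1 ler01
  (fun x _ => continuous_normf _ _ (cg x)).
have C0 : 0 < `|g c| + 1 by rewrite ltr_wpDl.
apply/cvgrPdist_lt => e e0; rewrite normr0 average0.
have d0 : 0 < Num.min 1 (e / (`|g c| + 1)) by rewrite lt_min ltr01 divr_gt0.
apply/nbhs_ballP; exists (Num.min 1 (e / (`|g c| + 1))) => // s.
rewrite /ball/= !sub0r !normrN lt_min => /andP[s1 s2].
have : `|average g `|s| | <= (`|g c| + 1) * `|s|.
  apply: average_le_lin => // t /andP[t0 ts].
  rewrite (le_trans (hc t _)) ?lerDl// t0/=.
  exact: le_trans ts (ltW s1).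
by move=> /le_lt_trans; apply; rewrite mulrC -ltr_pdivlMr.
Qed.

Lemma radial_deriv g r : continuous g -> 0 < r ->
  has_deriv (radial g) r (average g r).
Proof.
move=> cg r0; have h := has_deriv_primitive _ r (continuous_average g cg) (N1_lt _ (ltW r0)).
rewrite gtr0_norm// in h; apply: near_has_deriv h.
near=> s; rewrite /radial gtr0_norm//; near: s; exact: lt_nbhsr.
Unshelve. all: by end_near. Qed.

Lemma continuous_radial g : continuous g -> continuous (radial g).
Proof.
move=> cg x.
have h : {for `|x|, continuous (primitive (fun s => average g `|s|))}.
  by apply: continuous_primitive; [exact: continuous_average|exact: N1_lt].
by apply: (continuous_comp _ h); exact: norm_continuous.
Qed.

Lemma radial_norm g r : radial g `|r| = radial g r.
Proof. by rewrite /radial normr_id. Qed.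

Lemma radial_diff_le_exp g1 g2 C mu r :
  continuous g1 -> continuous g2 -> 0 < mu -> 0 <= r -> 0 <= C ->
  (forall t, 0 <= t <= r -> `|g1 t - g2 t| <= C * expR (mu * t)) ->
  `|radial g1 r - radial g2 r| <= C * expR (mu * r) / mu ^+ 2.
Proof.
move=> c1 c2 mu0 r0 C0 hg.
have /= := derive_norm_le (fun t => radial g1 t + - radial g2 t)
  (fun t => C * expR (mu * t) / mu ^+ 2)
  (fun t => average g1 t + - average g2 t) (fun t => C * expR (mu * t) / mu) 0 r r0.
rewrite !radial0 !(oppr0, addr0) => h; apply: (le_trans (h _ _ _ _ _)).
- move=> x /andP[x0 _].
  by have h1 := radial_deriv g1 x c1 x0; have h2 := radial_deriv g2 x c2 x0; der.
- move=> x _; apply: has_deriv_eq; first by der.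
  by rewrite /=; field; rewrite gt_eqF.
- move=> x _; have h1 := continuous_radial g1 c1 x.
  by have h2 := continuous_radial g2 c2 x; cont.
- move=> x _; apply: (@has_deriv_continuous _ _ _ (C * expR (mu * x) / mu)).
  apply: has_deriv_eq; first by der.
  by rewrite /=; field; rewrite gt_eqF.
- move=> x /andP[/ltW x0 xr]; apply: average_diff_le_exp => // t /andP[t0 tx].
  by apply: hg; rewrite t0 (le_trans tx)// ltW.
by rewrite gerBl divr_ge0 ?mulr_ge0 ?expR_ge0 ?exprn_ge0// ltW.
Qed.

Lemma radial_cst0 r : radial (fun=> 0) r = 0.
Proof.
have c0 : continuous (fun _ : R => 0 : R) by move=> x; cont.
rewrite -radial_norm.
have /= := derive_norm_le (radial (fun=> 0)) (fun=> 0) (fun=> 0) (fun=> 0) 0 `|r| (normr_ge0 _).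
rewrite !radial0 !subr0 => h; apply/eqP; rewrite -normr_le0; apply: h.
- move=> x /andP[x0 _]; apply: has_deriv_eq; first exact: radial_deriv.
  by rewrite average_cst0// ltW.
- by move=> x _; der.
- by move=> x _; exact: continuous_radial.
- by move=> x _; cont.
- by move=> x _; rewrite normr0.
Qed.

(* Multiplying by [e^(-mu r)] turns the integral inequality into a contraction
   of factor [L / mu^2 <= 1/2]. *)
Lemma radial_gronwall g1 g2 y1 y2 (a1 a2 L E mu T : R) :
  continuous g1 -> continuous g2 -> continuous y1 -> continuous y2 ->
  0 <= L -> 2 * L <= mu ^+ 2 -> 1 <= mu -> 0 <= E ->
  (forall r, 0 <= r <= T -> y1 r = a1 - radial g1 r) ->
  (forall r, 0 <= r <= T -> y2 r = a2 - radial g2 r) ->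
  (forall t, 0 <= t <= T -> `|g1 t - g2 t| <= L * `|y1 t - y2 t| + E * expR (mu * t)) ->
  forall r, 0 <= r <= T -> `|y1 r - y2 r| <= 2 * (`|a1 - a2| + E) * expR (mu * r).
Proof.
move=> cg1 cg2 cy1 cy2 L0 Lmu mu1 E0 e1 e2 hg r rT.
have mu0 : 0 < mu by rewrite (lt_le_trans ltr01).
have T0 : 0 <= T by case/andP: rT => /le_trans; exact.
pose D s := `|y1 s + - y2 s| * expR (- (mu * s)).
have [|c cT hc] := max_attained D 0 T T0.
  move=> x _; have h1 := cy1 x; have h2 := cy2 x.
  have h3 : {for x, continuous (fun s => expR (- (mu * s)))}.
    by apply: has_deriv_continuous; der.
  by rewrite /D; cont.
have expK s : expR (- (mu * s)) * expR (mu * s) = 1.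
  by rewrite -expRD addNr expR0.
have hD s : 0 <= s <= T -> `|y1 s - y2 s| <= D c * expR (mu * s).
  move=> /hc h; rewrite -[leLHS]mulr1 -(expK s) mulrA ler_pM2r ?expR_gt0//.
have Dc0 : 0 <= D c by rewrite /D mulr_ge0 ?expR_ge0.
have key s : 0 <= s <= T ->
    `|y1 s - y2 s| <= `|a1 - a2| + (L * D c + E) * expR (mu * s) / mu ^+ 2.
  move=> /[dup] sT /andP[s0 sT']; rewrite e1// e2//.
  have -> : a1 - radial g1 s - (a2 - radial g2 s) =
            (a1 - a2) - (radial g1 s - radial g2 s) by ring.
  apply: (le_trans (ler_normB _ _)); rewrite lerD2l.
  apply: radial_diff_le_exp => //; first by rewrite addr_ge0// mulr_ge0.
  move=> t /andP[t0 ts]; have tT : 0 <= t <= T by rewrite t0 (le_trans ts).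
  apply: (le_trans (hg t tT)); rewrite mulrDl lerD2r -mulrA ler_wpM2l//.
  exact: hD.
(* Taking [key] at the maximum point [c] bounds [D c] by half of itself plus data, and the half is
   absorbed on the left. *)
have Kc : D c <= `|a1 - a2| + (L * D c + E) / mu ^+ 2.
  have := key c cT; rewrite -(ler_pM2r (expR_gt0 (- (mu * c)))) => /le_trans; apply.
  rewrite mulrDl; apply: lerD.
    rewrite ler_piMr// -expR0 ler_expR oppr_le0 mulr_ge0//; first exact: ltW.
    by case/andP: cT.
  rewrite [leLHS](_ : _ = (L * D c + E) / mu ^+ 2 * (expR (- (mu * c)) * expR (mu * c))); last by ring.
  by rewrite expK mulr1.
have mu2 : 1 <= mu ^+ 2 by rewrite exprn_ege1.
have half : (L * D c + E) / mu ^+ 2 <= D c / 2 + E.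
  rewrite ler_pdivrMr ?exprn_gt0// mulrDl; apply: lerD; last by rewrite ler_peMr.
  have -> : D c / 2 * mu ^+ 2 = mu ^+ 2 / 2 * D c by ring.
  by rewrite ler_wpM2r// ler_pdivlMr// mulrC.
have Dfin : D c <= 2 * (`|a1 - a2| + E).
  move: Kc half; set Q := (_ / mu ^+ 2); set A := `|a1 - a2|.
  by move: Q A (D c) => Q A d h1 h2; lra.
by apply: (le_trans (hD r rT)); rewrite ler_pM2r ?expR_gt0.
Qed.

End radial_operator.

(** * Picard iteration *)

Section picard.
Context {R : realType}.
Implicit Types (r t x C : R) (y : R -> R) (n : nat).
Variables (k : nat) (h : R -> R -> R) (L a : R).
Hypothesis L0 : 0 <= L.
Hypothesis ch : forall y : R -> R, continuous y -> continuous (fun t : R => h t (y t)).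
Hypothesis hlip : forall t x y : R, `|h t x - h t y| <= L * `|x - y|.
Hypothesis h0 : forall t, h t 0 = 0.

(** Chosen so that [2 L <= mu^2]: in the norm weighted by [e^(-mu |r|)] the map [Phi] halves
    distances, on the whole line at once. *)
Let mu := 2 * L + 1.
Let Phi (y : R -> R) (r : R) := a - radial k (fun t : R => h t (y t)) r.
Let Y n := iter n Phi (fun=> a).
Let c n (r : R) := `|a| * expR (mu * `|r|) / 2 ^+ n.

Let mu0 : 0 < mu. Proof. by rewrite ltr_wpDl// mulr_ge0. Qed.

Let Lmu C : 0 <= C -> L * C / mu ^+ 2 <= C / 2.
Proof.
move=> C0; rewrite ler_pdivrMr ?exprn_gt0//.
have -> : C / 2 * mu ^+ 2 = L * C + C * (1 / 2 + L + 2 * L ^+ 2) by rewrite /mu; field.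
by rewrite lerDl mulr_ge0// !addr_ge0// ?mulr_ge0// sqr_ge0.
Qed.

Let cPhi y : continuous y -> continuous (Phi y).
Proof.
move=> cy x; have := continuous_radial k _ (ch y cy) x => hr.
by rewrite /Phi; cont.
Qed.

Let cY n : continuous (Y n).
Proof. by elim: n => [|n IH]; [move=> x; exact: (continuous_cstf a x)|exact: cPhi]. Qed.

Let contraction y1 y2 C : continuous y1 -> continuous y2 -> 0 <= C ->
  (forall r, `|y1 r - y2 r| <= C * expR (mu * `|r|)) ->
  forall r, `|Phi y1 r - Phi y2 r| <= C / 2 * expR (mu * `|r|).
Proof.
move=> c1 c2 C0 hy r.
have -> : Phi y1 r - Phi y2 r = - (radial k (fun t : R => h t (y1 t)) `|r|
   - radial k (fun t : R => h t (y2 t)) `|r|).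
  rewrite !radial_norm /Phi.
  by move: (radial _ _ r) (radial k (fun t : R => h t (y2 t)) r) => p q; ring.
rewrite normrN; apply: (@le_trans _ _ (L * C * expR (mu * `|r|) / mu ^+ 2)).
  apply: radial_diff_le_exp => //; [exact: ch|exact: ch|exact: mulr_ge0|].
  move=> t /andP[t0 _]; apply: (le_trans (hlip _ _ _)).
  by rewrite -mulrA ler_wpM2l// -{3}(ger0_norm t0).
rewrite mulrAC ler_pM2r ?expR_gt0//; exact: Lmu.
Qed.

Let Ystep n r : `|Y n.+1 r - Y n r| <= `|a| / 2 ^+ n.+1 * expR (mu * `|r|).
Proof.
elim: n r => [|n IH] r; last first.
  have := contraction (Y n.+1) (Y n) (`|a| / 2 ^+ n.+1) (cY _) (cY _) _ IH r.
  rewrite (_ : `|a| / 2 ^+ n.+1 / 2 = `|a| / 2 ^+ n.+2); last by rewrite (exprS _ n.+1) invfM mulrA [RHS]mulrAC.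
  by apply; rewrite divr_ge0// exprn_ge0.
have -> : Y 1 r - Y 0 r = - (radial k (fun t : R => h t a) `|r|
    - radial k (fun=> 0) `|r|).
  by rewrite radial_cst0 radial_norm /Y /= /Phi; ring.
rewrite normrN; apply: (@le_trans _ _ (L * `|a| * expR (mu * `|r|) / mu ^+ 2)).
  apply: radial_diff_le_exp => //.
  - by apply: (ch (fun=> a)) => x; cont.
  - by move=> x; cont.
  - exact: mulr_ge0.
  - move=> t /andP[t0 _]; rewrite -(h0 t); apply: (le_trans (hlip _ _ _)).
    rewrite subr0 ler_peMr ?mulr_ge0// -expR0 ler_expR mulr_ge0//.
    exact: ltW.
by rewrite mulrAC expr1 ler_pM2r ?expR_gt0//; exact: Lmu.
Qed.

Let c_ge0 n r : 0 <= c n r.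
Proof. by rewrite divr_ge0 ?mulr_ge0 ?expR_ge0// exprn_ge0. Qed.

Let Ycauchy n p r : `|Y (n + p) r - Y n r| <= c n r - c (n + p) r.
Proof.
elim: p => [|p IH]; first by rewrite addn0 !subrr normr0.
rewrite addnS; have := Ystep (n + p) r.
have -> : `|a| / 2 ^+ (n + p).+1 * expR (mu * `|r|) = c (n + p) r - c (n + p).+1 r.
  by rewrite /c exprS; field; rewrite expf_neq0.
move=> h1.
have -> : c n r - c (n + p).+1 r = (c (n + p) r - c (n + p).+1 r) + (c n r - c (n + p) r).
  by ring.
apply: (le_trans _ (lerD h1 IH)).
rewrite (_ : Y (n + p).+1 r - Y n r = (Y (n + p).+1 r - Y (n + p) r) + (Y (n + p) r - Y n r)).
  exact: ler_normD.
by ring.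
Qed.

(** By [Ycauchy] the sequence [Y n r - c n r] is nondecreasing, with each [Y p r + c p r] as an
    upper bound. Its supremum is therefore the limit of the iterates, with error at most [c n r]. *)
Let S (r : R) := [set z | exists n, z = Y n r - c n r].
Let y (r : R) := sup (S r).

Let S_ub n r : ubound (S r) (Y n r + c n r).
Proof.
move=> _ [p ->]; have [pn|np] := leqP n p.
  have := Ycauchy n (p - n) r; rewrite subnKC// ler_norml => /andP[_ h1].
  by have := c_ge0 p r; move: h1; move: (Y p r) (Y n r) (c n r) (c p r) => *; lra.
have := Ycauchy p (n - p) r; rewrite subnKC 1?ltnW// ler_norml => /andP[h1 _].
by have := c_ge0 n r; move: h1; move: (Y p r) (Y n r) (c n r) (c p r) => *; lra.
Qed.

Let y_near n r : `|y r - Y n r| <= c n r.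
Proof.
have hS : has_sup (S r).
  by split; [exists (Y 0 r - c 0 r); exists 0%N|exists (Y 0 r + c 0 r); exact: S_ub].
rewrite ler_distl; apply/andP; split.
  by apply: ub_le_sup; [case: hS|exists n].
by apply: ge_sup; [case: hS|exact: S_ub].
Qed.

Lemma geometric_small (C e : R) : 0 <= C -> 0 < e -> exists n, C / 2 ^+ n < e.
Proof.
move=> C0 e0; exists (Num.truncn (C / e)).+1.
rewrite ltr_pdivrMr ?exprn_gt0// -ltr_pdivrMl// mulrC.
apply: (lt_trans (truncnS_gt (C / e))).
by rewrite -natrX ltr_nat ltn_expl.
Qed.

Let cy : continuous y.
Proof.
move=> x; apply/cvgrPdist_lt => e e0.
have C0 : 0 <= `|a| * expR (mu * (`|x| + 1)) by rewrite mulr_ge0 ?expR_ge0.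
have e30 : 0 < e / 3 by rewrite divr_gt0.
have [n hn] := geometric_small _ (e / 3) C0 e30.
have hc s : `|s| <= `|x| + 1 -> c n s < e / 3.
  move=> hs; apply: le_lt_trans hn; rewrite ler_pM2r ?invr_gt0 ?exprn_gt0//.
  by rewrite ler_wpM2l// ler_expR ler_pM2l.
have := cY n x => /cvgrPdist_lt /(_ _ e30) hY.
near=> s.
have -> : y x - y s = (y x - Y n x) + (Y n x - Y n s) - (y s - Y n s) by ring.
have h1 : `|y x - Y n x| < e / 3.
  by apply: (le_lt_trans (y_near n x)); apply: hc; rewrite lerDl.
have h2 : `|y s - Y n s| < e / 3.
  apply: (le_lt_trans (y_near n s)); apply: hc.
  have : `|x - s| < 1 by near: s; exact: (nbhsx_ballx x 1 ltr01).
  have := ler_distD x 0 s; rewrite !sub0r !normrN => h3 h4.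
  by apply: (le_trans h3); rewrite lerD2l ltW.
have h3 : `|Y n x - Y n s| < e / 3 by near: s.
apply: (le_lt_trans (ler_normB _ _)).
apply: (@le_lt_trans _ _ (`|y x - Y n x| + `|Y n x - Y n s| + `|y s - Y n s|)).
  by rewrite lerD2r ler_normD.
move: h1 h2 h3; move: `|y x - Y n x| `|Y n x - Y n s| `|y s - Y n s| => p q t *; lra.
Unshelve. all: by end_near. Qed.

Lemma picard : exists y : R -> R, continuous y /\
  forall r, y r = a - radial k (fun t : R => h t (y t)) r.
Proof.
exists y; split; first exact: cy.
move=> r; apply/eqP; rewrite -subr_eq0 -normr_le0; apply/ler_addgt0Pr => e e0.
rewrite add0r.
have C0 : 0 <= `|a| * expR (mu * `|r|) by rewrite mulr_ge0 ?expR_ge0.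
have [n hn] := geometric_small _ e C0 e0; apply/ltW/(le_lt_trans _ hn).
rewrite -/(Phi y r) -/(c n r).
have -> : y r - Phi y r = (y r - Y n.+1 r) + (Phi (Y n) r - Phi y r).
  by rewrite -[Y n.+1 r]/(Phi (Y n) r) subrKA.
have h1 : `|Phi (Y n) r - Phi y r| <= `|a| / 2 ^+ n / 2 * expR (mu * `|r|).
  apply: (contraction (Y n) y _ (cY n) cy); first by rewrite divr_ge0 ?exprn_ge0.
  move=> s; rewrite distrC; apply: (le_trans (y_near n s)).
  by rewrite /c mulrAC.
apply: (le_trans (ler_normD _ _)); apply: (le_trans (lerD (y_near n.+1 r) h1)).
rewrite /c exprS le_eqVlt; apply/orP; left; apply/eqP.
by field; rewrite expf_neq0.
Qed.

End picard.

(** * The shooting solution *)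

Section shooting.
Context {R : realType}.
Variables (m : nat) (alpha : R).
Hypothesis alpha0 : 0 < alpha.
Implicit Types (lam t r x y a T s : R).

(* With [u = r^m v], the vortex equation reads
   [(r^(2m+1) v')' + r^(2m+1) potential lam r v * v = 0] where [lam = - 2 kappa]. *)
Definition potential lam t x :=
  2 * (t ^+ m * x) ^+ 2 / (1 + alpha * (t ^+ m * x) ^+ 2) + lam.

Lemma one_add_sq_gt0 (c x : R) : 0 <= c -> 0 < 1 + c * x ^+ 2.
Proof. by move=> c0; rewrite ltr_pwDl// mulr_ge0 ?exprn_even_ge0. Qed.

Lemma potential_bounds lam t x : lam <= potential lam t x <= lam + 2 / alpha.
Proof.
have h := one_add_sq_gt0 alpha (t ^+ m * x) (ltW alpha0).
rewrite /potential; set s := t ^+ m * x in h *.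
apply/andP; split.
  rewrite lerDr; apply: divr_ge0; last exact: ltW.
  by rewrite mulr_ge0 ?exprn_even_ge0.
rewrite addrC lerD2l ler_pdivrMr// -subr_ge0.
have -> : 2 / alpha * (1 + alpha * s ^+ 2) - 2 * s ^+ 2 = 2 / alpha.
  by field; rewrite gt_eqF.
by rewrite divr_ge0// ltW.
Qed.

Lemma potential_norm lam Lam t x : `|lam| <= Lam -> `|potential lam t x| <= Lam + 4 / alpha.
Proof.
move=> hl; have /andP[h1 h2] := potential_bounds lam t x.
have ia : 0 <= alpha^-1 by rewrite invr_ge0 ltW.
move: hl; rewrite !ler_norml => /andP[l1 l2]; apply/andP; split; lra.
Qed.

Definition source lam (v : R -> R) t := potential lam t (v t) * v t.

Lemma continuous_source lam (v : R -> R) : continuous v -> continuous (source lam v).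
Proof.
move=> cv x; have := cv x => ?; rewrite /source /potential; cont.
by rewrite gt_eqF// one_add_sq_gt0// ltW.
Qed.

Let saturation_lip (c x y : R) : 0 <= c ->
  `|x / (1 + c * x ^+ 2) - y / (1 + c * y ^+ 2)| <= `|x - y|.
Proof.
move=> c0; have hx := one_add_sq_gt0 c x c0; have hy := one_add_sq_gt0 c y c0.
have -> : x / (1 + c * x ^+ 2) - y / (1 + c * y ^+ 2) =
  (x - y) * ((1 - c * x * y) / ((1 + c * x ^+ 2) * (1 + c * y ^+ 2))).
  by field; rewrite !gt_eqF.
rewrite normrM ler_piMr// normrM normfV [X in _ / X]gtr0_norm ?mulr_gt0//.
rewrite ler_pdivrMr ?mulr_gt0// mul1r.
have h1 : 0 <= c * (x + y) ^+ 2 by rewrite mulr_ge0 ?exprn_even_ge0.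
have h2 : 0 <= c * (x - y) ^+ 2 by rewrite mulr_ge0 ?exprn_even_ge0.
have h3 : 0 <= (c * x * y) ^+ 2 by rewrite exprn_even_ge0.
have h4 : 0 <= c * x ^+ 2 by rewrite mulr_ge0 ?exprn_even_ge0.
have h5 : 0 <= c * y ^+ 2 by rewrite mulr_ge0 ?exprn_even_ge0.
by rewrite ler_norml; apply/andP; split; nra.
Qed.

(** Writing [2 s^2 x / (1 + alpha s^2 x^2)] as [(2 / alpha) (x - x / (1 + alpha s^2 x^2))], with
    [s = t^m], leaves the function [x / (1 + c x^2)], which is 1-Lipschitz for every [c >= 0]. Hence
    the constant does not depend on [t]. *)
Lemma source_lip lam Lam t x y : `|lam| <= Lam ->
  `|potential lam t x * x - potential lam t y * y| <= (Lam + 4 / alpha) * `|x - y|.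
Proof.
move=> hl.
have ia : 0 < alpha^-1 by rewrite invr_gt0.
have E z : potential lam t z * z = lam * z + 2 / alpha * z
    - 2 / alpha * (z / (1 + alpha * (t ^+ m) ^+ 2 * z ^+ 2)).
  have := one_add_sq_gt0 alpha (t ^+ m * z) (ltW alpha0).
  rewrite /potential exprMn mulrA => h; field.
  by rewrite !gt_eqF.
rewrite !E.
have c0 : 0 <= alpha * (t ^+ m) ^+ 2 by rewrite mulr_ge0 ?exprn_even_ge0// ltW.
have := saturation_lip _ x y c0.
set p := x / _; set q := y / _ => h.
have -> : lam * x + 2 / alpha * x - 2 / alpha * p - (lam * y + 2 / alpha * y - 2 / alpha * q)
  = lam * (x - y) + 2 / alpha * (x - y) - 2 / alpha * (p - q) by ring.
apply: (le_trans (ler_normB _ _)).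
have h1 : `|2 / alpha * (p - q)| <= 2 / alpha * `|x - y|.
  by rewrite normrM gtr0_norm ?divr_gt0// ler_pM2l ?divr_gt0.
have h2 : `|lam * (x - y) + 2 / alpha * (x - y)| <= (Lam + 2 / alpha) * `|x - y|.
  apply: (le_trans (ler_normD _ _)); rewrite [leRHS]mulrDl; apply: lerD.
    by rewrite normrM ler_wpM2r.
  by rewrite normrM gtr0_norm ?divr_gt0.
apply: (le_trans (lerD h2 h1)); rewrite -mulrDl.
by have -> : Lam + 2 / alpha + 2 / alpha = Lam + 4 / alpha by ring.
Qed.

Lemma shooting_exists a lam : exists v : R -> R, continuous v /\
  forall r, v r = a - radial (2 * m) (source lam v) r.
Proof.
apply: (picard (2 * m) (fun t x => potential lam t x * x) (`|lam| + 4 / alpha)).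
- by rewrite addr_ge0// divr_ge0// ltW.
- by move=> y cy; exact: continuous_source.
- by move=> t x y; exact: source_lip.
- by move=> t; rewrite mulr0.
Qed.

Definition shoot a lam : R -> R := projT1 (cid (shooting_exists a lam)).

Lemma continuous_shoot a lam : continuous (shoot a lam).
Proof. by rewrite /shoot; case: cid => v []. Qed.

Lemma shootE a lam r : shoot a lam r = a - radial (2 * m) (source lam (shoot a lam)) r.
Proof. by rewrite /shoot; case: cid => v []. Qed.

Opaque shoot.

Lemma shoot0 a lam : shoot a lam 0 = a.
Proof. by rewrite shootE radial0 subr0. Qed.

Definition dshoot a lam r := - average (2 * m) (source lam (shoot a lam)) r.

Lemma shoot_deriv a lam r : 0 < r -> has_deriv (shoot a lam) r (dshoot a lam r).
Proof.
move=> r0; have h := radial_deriv (2 * m) _ r (continuous_source lam _ (continuous_shoot a lam)) r0.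
rewrite (_ : shoot a lam = fun r => a + - radial (2 * m) (source lam (shoot a lam)) r); last first.
  by apply/funext => s; rewrite -shootE.
by apply: has_deriv_eq; [der|rewrite add0r].
Qed.

(** The quantity [r^(2m+1) v'] of the divergence form, not the energy flux. Unlike [dshoot], it is
    handled up to and including [r = 0]. *)
Definition shoot_flux a lam r := - moment (2 * m) (source lam (shoot a lam)) r.

Lemma dshootE a lam r : dshoot a lam r = shoot_flux a lam r / r ^+ (2 * m).+1.
Proof. by rewrite /dshoot /shoot_flux /average mulNr. Qed.

Lemma shoot_fluxE a lam r : 0 < r -> shoot_flux a lam r = r ^+ (2 * m).+1 * dshoot a lam r.
Proof. by move=> r0; rewrite dshootE mulrC divfK// expf_neq0// gt_eqF. Qed.

Lemma shoot_flux0 a lam : shoot_flux a lam 0 = 0.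
Proof. by rewrite /shoot_flux moment0 oppr0. Qed.

Lemma shoot_flux_deriv a lam r : 0 <= r ->
  has_deriv (shoot_flux a lam) r (- (r ^+ (2 * m).+1 * source lam (shoot a lam) r)).
Proof.
move=> r0; apply: has_deriv_opp; apply: moment_deriv => //.
exact: continuous_source (continuous_shoot a lam).
Qed.

Lemma dshoot_deriv a lam r : 0 < r -> has_deriv (dshoot a lam) r
  (- source lam (shoot a lam) r - (2 * m).+1%:R * dshoot a lam r / r).
Proof.
move=> r0; have h := shoot_flux_deriv a lam r (ltW r0).
rewrite (_ : dshoot a lam = fun r => shoot_flux a lam r * (r ^+ (2 * m).+1)^-1); last first.
  by apply/funext => s; rewrite dshootE.
apply: has_deriv_eq.
  by der; rewrite expf_neq0// gt_eqF.
rewrite /= shoot_fluxE//; move: (dshoot a lam r) (source _ _ _) (2 * m)%N => w g k.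
by rewrite !exprS; field; rewrite gt_eqF//= expf_neq0// gt_eqF.
Qed.

(** * Bounds and Lipschitz dependence, uniform for [|lam| <= Lam] on [[0, T]] *)

Section bounds.
Variables (Lam T : R).
Hypothesis Lam0 : 0 <= Lam.
Let L := Lam + 4 / alpha.
Let mu := 2 * L + 1.

Let L0 : 0 <= L. Proof. by rewrite addr_ge0// divr_ge0// ltW. Qed.
Let mu0 : 0 < mu. Proof. by rewrite ltr_wpDl// mulr_ge0. Qed.
Let mu1 : 1 <= mu. Proof. by rewrite lerDr mulr_ge0. Qed.
Let Lmu : 2 * L <= mu ^+ 2.
Proof.
have -> : mu ^+ 2 = 2 * L + (2 * L + 4 * L ^+ 2 + 1) by rewrite /mu; ring.
by rewrite lerDl !addr_ge0// mulr_ge0// exprn_ge0.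
Qed.

Let B := expR (mu * T).
Let expB r : r <= T -> expR (mu * r) <= B.
Proof. by move=> rT; rewrite ler_expR ler_pM2l. Qed.

(** Gronwall against the zero solution. *)
Lemma shoot_le a lam r : `|lam| <= Lam -> 0 <= r <= T ->
  `|shoot a lam r| <= 2 * `|a| * B.
Proof.
move=> hl rT; have c0 : continuous (fun _ : R => 0 : R) by move=> x; cont.
have cv := continuous_shoot a lam.
have e2 s : 0 <= s <= T -> (fun=> 0 : R) s = 0 - radial (2 * m) (fun=> 0) s.
  by rewrite radial_cst0 subr0.
have hg t : 0 <= t <= T ->
    `|source lam (shoot a lam) t - 0| <= L * `|shoot a lam t - 0| + 0 * expR (mu * t).
  by rewrite !subr0 mul0r addr0 /source normrM ler_wpM2r// potential_norm.
have h := radial_gronwall (2 * m) (source lam (shoot a lam)) (fun=> 0)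
  (shoot a lam) (fun=> 0) a 0 L 0 mu T (continuous_source lam _ cv) c0 cv c0
  L0 Lmu mu1 (lexx 0) (fun s _ => shootE a lam s) e2 hg r rT.
rewrite !subr0 addr0 in h.
apply: (le_trans h); rewrite ler_wpM2l ?mulr_ge0// expB//.
by case/andP: rT.
Qed.

(** Changing [lam] to [lam'] in the source adds the forcing term [(lam - lam') v'], with [v'] the
    second solution; [shoot_le] bounds it and Gronwall takes it as [E]. *)
Lemma shoot_lip a lam a' lam' r : `|lam| <= Lam -> `|lam'| <= Lam -> 0 <= r <= T ->
  `|shoot a lam r - shoot a' lam' r|
    <= 2 * (`|a - a'| + `|lam - lam'| * (2 * `|a'| * B)) * B.
Proof.
move=> hl hl' rT.
have rT' : r <= T by case/andP: rT.
have cv := continuous_shoot a lam; have cv' := continuous_shoot a' lam'.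
pose E := `|lam - lam'| * (2 * `|a'| * B).
have E0 : 0 <= E by rewrite !mulr_ge0// expR_ge0.
have h := radial_gronwall (2 * m) (source lam (shoot a lam)) (source lam' (shoot a' lam'))
  (shoot a lam) (shoot a' lam') a a' L E mu T (continuous_source _ _ cv)
  (continuous_source _ _ cv') cv cv' L0 Lmu mu1 E0 (fun s _ => shootE a lam s)
  (fun s _ => shootE a' lam' s).
apply: (le_trans (h _ r rT)); last first.
  by rewrite ler_wpM2l ?expB// mulr_ge0// addr_ge0.
move=> t tT; have t0 : 0 <= t by case/andP: tT.
have -> : source lam (shoot a lam) t - source lam' (shoot a' lam') t =
   (source lam (shoot a lam) t - source lam (shoot a' lam') t)
   + (lam - lam') * shoot a' lam' t.
  rewrite /source /potential; move: (shoot a lam t) (shoot a' lam' t) => x y.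
  by move: (_ / (1 + alpha * (t ^+ m * y) ^+ 2)) => q; ring.
apply: (le_trans (ler_normD _ _)); apply: lerD; first exact: source_lip.
rewrite normrM; apply: (@le_trans _ _ E).
  by rewrite ler_wpM2l// shoot_le.
by rewrite ler_peMr// -expR0 ler_expR mulr_ge0// ltW.
Qed.

(** The bound is proportional to [|a|], so the radius up to which the solution keeps at least half
    its initial height can be chosen independently of [a]. *)
Lemma shoot_near_start a lam r : `|lam| <= Lam -> 0 <= r <= T ->
  `|shoot a lam r - a| <= 2 * `|a| * (L * B * T) * r.
Proof.
move=> hl /andP[r0 rT].
have cs := continuous_source lam _ (continuous_shoot a lam).
have hs t : 0 <= t <= T -> `|source lam (shoot a lam) t| <= L * (2 * `|a| * B).
  move=> tT; rewrite /source normrM; apply: ler_pM => //.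
    exact: potential_norm.
  exact: shoot_le.
have := derive_norm_le (shoot a lam) (fun t => 2 * `|a| * (L * B * T) * t)
  (dshoot a lam) (fun=> 2 * `|a| * (L * B * T)) 0 r r0.
rewrite mulr0 subr0 shoot0; apply.
- by move=> x /andP[x0 _]; exact: shoot_deriv.
- by move=> x _; apply: has_deriv_eq; [der|rewrite /=; ring].
- by move=> x _; exact: continuous_shoot.
- by move=> x _; cont.
- move=> x /andP[x0 xr]; rewrite normrN.
  have xT : x <= T by rewrite (le_trans (ltW xr)).
  apply: (le_trans (average_le_lin (2 * m) _ (L * (2 * `|a| * B)) x cs (ltW x0) _)).
    by move=> t /andP[t0 tx]; apply: hs; rewrite t0 (le_trans tx).
  rewrite (_ : 2 * `|a| * (L * B * T) = L * (2 * `|a| * B) * T); last by ring.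
  by rewrite ler_wpM2l// !mulr_ge0// expR_ge0.
Qed.

End bounds.

End shooting.

(** * Extreme parameters and touching points *)

Section edges.
Context {R : realType}.
Variables (m : nat) (alpha Rad a lam : R).
Hypothesis alpha0 : 0 < alpha.
Hypothesis Rad0 : 0 < Rad.
Hypothesis a0 : 0 < a.
Implicit Types (r s t x : R).

Local Notation v := (shoot m alpha alpha0 a lam).
Local Notation w := (dshoot m alpha alpha0 a lam).
Local Notation z := (shoot_flux m alpha alpha0 a lam).
Local Notation g := (source m alpha lam v).
Local Notation pot r := (potential m alpha lam r (v r)).
Let k := (2 * m).+1.

Let cv r : {for r, continuous v}. Proof. exact: continuous_shoot. Qed.
Let cz r : 0 <= r -> {for r, continuous z}.
Proof. by move=> r0; exact: has_deriv_continuous (shoot_flux_deriv _ _ _ _ _ _ r0). Qed.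
Let dv r : 0 < r -> has_deriv v r (w r). Proof. exact: shoot_deriv. Qed.
Let dw r : 0 < r -> has_deriv w r (- g r - k%:R * w r / r).
Proof. exact: dshoot_deriv. Qed.
Let dz r : 0 <= r -> has_deriv z r (- (r ^+ k * g r)).
Proof. exact: shoot_flux_deriv. Qed.
Let z0 : z 0 = 0. Proof. exact: shoot_flux0. Qed.
Let zE r : 0 < r -> z r = r ^+ k * w r. Proof. exact: shoot_fluxE. Qed.
Let v0 : v 0 = a. Proof. exact: shoot0. Qed.

(* If the potential is nonpositive then [(r^k v' v)' >= 0], so [v^2] increases. *)
Lemma shoot_pos_of_low : lam <= - (2 / alpha) -> forall r, 0 <= r -> 0 < v r.
Proof.
move=> hlam.
have pot0 r : pot r <= 0.
  have /andP[_ h] := potential_bounds m alpha alpha0 lam r (v r).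
  by rewrite (le_trans h)// -lerBrDr sub0r.
have zv r : 0 <= r -> 0 <= z r * v r.
  move=> r0; have := derive_ge0_le (fun t => z t * v t)
    (fun t => - (t ^+ k * g t) * v t + z t * w t) 0 r r0.
  rewrite z0 mul0r; apply.
  - by move=> x /andP[x0 _]; have h1 := dz x (ltW x0); have h2 := dv x x0; der.
  - by move=> x /andP[x0 _]; have h1 := cz x x0; have h2 := cv x; cont.
  - move=> x /andP[x0 _]; rewrite zE// /source.
    rewrite (_ : _ + _ = x ^+ k * (- pot x * v x ^+ 2 + w x ^+ 2)); last first.
      by move: (w x) (pot x) => t p; move: (v x) => q; ring.
    apply: mulr_ge0; first by rewrite exprn_ge0// ltW.
    by rewrite addr_ge0 ?exprn_even_ge0// mulr_ge0 ?exprn_even_ge0// oppr_ge0.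
have vv r : 0 <= r -> a ^+ 2 <= v r ^+ 2.
  move=> r0; have := derive_ge0_le (fun t => v t ^+ 2) (fun t => 2 * v t ^+ 1 * w t) 0 r r0.
  rewrite v0; apply.
  - by move=> x /andP[x0 _]; have h2 := dv x x0; der.
  - by move=> x /andP[x0 _]; have h2 := cv x; cont.
  - move=> x /andP[x0 _]; rewrite expr1 -mulrA mulr_ge0//.
    have := zv x (ltW x0); rewrite zE// -mulrA pmulr_rge0 ?exprn_gt0//.
    by rewrite mulrC.
move=> r r0; rewrite ltNge; apply/negP => vr.
have va : 0 <= v 0 by rewrite v0 ltW.
have [c /andP[c0 _] vc] := zero_attained v 0 r r0 (fun x _ => cv x) va vr.
by have := vv c c0; rewrite vc expr0n/= leNgt exprn_gt0.
Qed.

(* The Riccati variable [q = - v' / v] satisfies [q' >= Lambda + q^2 / 2] on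
   [Rad / 2, Rad], hence blows up before [Rad] once [Lambda] is large. *)
Lemma shoot_not_pos_of_high :
  64 / Rad ^+ 2 + 2 * (k%:R / Rad) ^+ 2 <= lam ->
  exists2 r, 0 <= r <= Rad & v r <= 0.
Proof.
move=> hlam; apply: contrapT => nex.
have vpos r : 0 <= r -> r <= Rad -> 0 < v r.
  by move=> r0 rR; rewrite ltNge; apply/negP => h; apply: nex; exists r; rewrite ?r0.
(* On [[Rad / 2, Rad]] the damping [k / r] is at most [C], and [C q <= C^2 / 2 + q^2 / 2]. Growth at
   rate [Lb] over a length [Rad / 4] gives [q >= 16 / Rad] at [3 Rad / 4]; on the last quarter
   [1 / q] decreases at rate at least [1/2], so it would fall by [Rad / 8] from a value at most
   [Rad / 16]. *)
pose C := 2 * (k%:R / Rad); pose Lb := 64 / Rad ^+ 2.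
have C0 : 0 <= C by rewrite mulr_ge0// divr_ge0// ltW.
have Lb0 : 0 < Lb by rewrite divr_gt0// exprn_gt0.
have lamE : Lb + C ^+ 2 / 2 <= lam.
  by rewrite (_ : C ^+ 2 / 2 = 2 * (k%:R / Rad) ^+ 2)// /C; field; rewrite gt_eqF.
have lam0 : 0 <= lam by apply: le_trans lamE; rewrite addr_ge0 ?divr_ge0 ?exprn_even_ge0// ltW.
have potlam r : lam <= pot r by have /andP[] := potential_bounds m alpha alpha0 lam r (v r).
have wneg r : 0 < r -> r <= Rad -> w r <= 0.
  move=> r0 rR; rewrite -(pmulr_rle0 _ (exprn_gt0 k r0)) -zE// -oppr_ge0 -[0]oppr0 -{1}z0.
  apply: (derive_ge0_le (fun t => - z t) (fun t => - - (t ^+ k * g t))); first exact: ltW.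
  - by move=> x /andP[x0 _]; have h1 := dz x (ltW x0); der.
  - by move=> x /andP[x0 _]; have h1 := cz x x0; cont.
  - move=> x /andP[x0 xr]; rewrite opprK; apply: mulr_ge0; first by rewrite exprn_ge0// ltW.
    rewrite /source; apply: mulr_ge0; first exact: le_trans (potlam x).
    by apply/ltW/vpos; [exact: ltW|rewrite (le_trans (ltW xr))].
pose q r := - w r * (v r)^-1.
pose dq r := pot r - k%:R / r * q r + q r ^+ 2.
have q0 r : 0 < r -> r <= Rad -> 0 <= q r.
  by move=> r0 rR; rewrite mulr_ge0 ?oppr_ge0 ?wneg// invr_ge0 ltW// vpos// ltW.
have hdq r : 0 < r -> r <= Rad -> has_deriv q r (dq r).
  move=> r0 rR; have h1 := dv r r0; have h2 := dw r r0.
  have vr : v r != 0 by rewrite gt_eqF// vpos// ltW.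
  apply: (has_deriv_eq (fun t => - w t * (v t)^-1)); first by der.
  rewrite /dq /q /source; move: (pot r) (w r) vr; move: (v r) => x p y x0; field.
  by rewrite x0 gt_eqF.
have dqge r : Rad / 2 <= r -> r <= Rad -> Lb + q r ^+ 2 / 2 <= dq r.
  move=> r2 rR; have r0 : 0 < r by rewrite (lt_le_trans _ r2)// divr_gt0.
  have h1 : k%:R / r * q r <= C * q r.
    rewrite ler_wpM2r ?q0// /C ler_pdivrMr//.
    rewrite (_ : 2 * (k%:R / Rad) * r = k%:R * (r / (Rad / 2))); last by field; rewrite gt_eqF.
    by rewrite ler_peMr// ler_pdivlMr ?divr_gt0// mul1r.
  have h2 : C * q r <= C ^+ 2 / 2 + q r ^+ 2 / 2.
    rewrite -subr_ge0 (_ : _ - _ = (C - q r) ^+ 2 / 2); last by field.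
    by rewrite divr_ge0// exprn_even_ge0.
  have := potlam r; rewrite /dq; move: h1 h2 lamE.
  move: (pot r) (k%:R / r * q r) (C * q r) (C ^+ 2 / 2) => p b c d h1 h2 h3 h4.
  have e : q r ^+ 2 = q r ^+ 2 / 2 + q r ^+ 2 / 2 by field.
  rewrite e; move: (q r ^+ 2 / 2) h2 => f h2; lra.
clearbody q dq.
have R2 : 0 < Rad / 2 by rewrite divr_gt0.
pose R3 := 3 * Rad / 4.
have R23 : Rad / 2 <= R3 by rewrite /R3; lra.
have R3R : R3 <= Rad by rewrite /R3; lra.
have R30 : 0 < R3 by rewrite (lt_le_trans R2).
have big : Lb * Rad / 4 <= q R3.
  have : q (Rad / 2) + - (Lb * (Rad / 2)) <= q R3 + - (Lb * R3).
    apply: (derive_ge0_le (fun t => q t + - (Lb * t)) (fun t => dq t + - Lb)) => //.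
    - move=> x /andP[x1 x2].
      have h : has_deriv q x (dq x).
        by apply: hdq; [exact: lt_trans x1|rewrite (le_trans (ltW x2))].
      by apply: has_deriv_eq; [der|rewrite /=; ring].
    - move=> x /andP[x1 x2].
      have h : {for x, continuous q}.
        apply: (has_deriv_continuous _ _ _ (hdq x _ _)); first exact: lt_le_trans x1.
        by rewrite (le_trans x2).
      by cont.
    - move=> x /andP[x1 x2]; rewrite subr_ge0.
      apply: le_trans (dqge x (ltW x1) (le_trans (ltW x2) R3R)).
      by rewrite lerDl divr_ge0// exprn_even_ge0.
  have := q0 (Rad / 2) R2 (le_trans R23 R3R).
  have -> : Lb * Rad / 4 = Lb * R3 - Lb * (Rad / 2) by rewrite /R3; field.
  by move: (Lb * R3) (Lb * (Rad / 2)) (q _) (q R3) => *; lra.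
have qR3 : 0 < q R3 by apply: lt_le_trans big; rewrite divr_gt0// mulr_gt0.
have qpos r : R3 <= r -> r <= Rad -> 0 < q r.
  move=> r3 rR; apply: (lt_le_trans qR3).
  apply: (derive_ge0_le q dq) => //.
  - by move=> x /andP[x1 x2]; apply: hdq; [exact: lt_trans x1|rewrite (le_trans (ltW x2))].
  - move=> x /andP[x1 x2].
    apply: (has_deriv_continuous _ _ _ (hdq x _ _)); first exact: lt_le_trans x1.
    by rewrite (le_trans x2).
  - move=> x /andP[x1 x2]; apply: le_trans (dqge x _ _).
    + by rewrite addr_ge0 ?(ltW Lb0)// divr_ge0// exprn_even_ge0.
    + by rewrite (le_trans R23)// ltW.
    + by rewrite (le_trans (ltW x2)).
have : - (q R3)^-1 + - (R3 / 2) <= - (q Rad)^-1 + - (Rad / 2).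
  apply: (derive_ge0_le (fun t => - (q t)^-1 + - (t * 2^-1))
    (fun t => dq t / q t ^+ 2 + - 2^-1)) => //.
  - move=> x /andP[x1 x2].
    have h : has_deriv q x (dq x).
      by apply: hdq; [exact: lt_trans x1|rewrite ltW].
    apply: has_deriv_eq; first by der; rewrite gt_eqF// qpos// ltW.
    by rewrite /= mulNr opprK mul1r mulr0 addr0.
  - move=> x /andP[x1 x2].
    have h : {for x, continuous q}.
      by apply: (has_deriv_continuous _ _ _ (hdq x _ _)); [exact: lt_le_trans x1|].
    by cont; rewrite gt_eqF// qpos.
  - move=> x /andP[x1 x2]; have qx : 0 < q x by rewrite qpos// ltW.
    rewrite subr_ge0 ler_pdivlMr ?exprn_gt0// mulrC.
    apply: le_trans (dqge x _ (ltW x2)); last by rewrite (le_trans R23)// ltW.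
    by rewrite lerDr ltW.
have qinv : (q R3)^-1 <= Rad / 16.
  rewrite -[leRHS]invrK lef_pV2 ?posrE ?invr_gt0 ?divr_gt0//.
  apply: le_trans big; rewrite le_eqVlt; apply/orP; left; apply/eqP.
  by rewrite /Lb; field; rewrite gt_eqF.
have : 0 < (q Rad)^-1 by rewrite invr_gt0 qpos.
move: qinv; rewrite /R3; move: (q _)^-1 (q Rad)^-1 => x y; lra.
Qed.

(* At an interior touching point [v = v' = 0]; Gronwall backwards from there
   would force [v = 0] up to the center, where [v = a > 0]. *)
Lemma shoot_touching : (forall r, 0 <= r <= Rad -> 0 <= v r) ->
  forall c, 0 <= c < Rad -> 0 < v c.
Proof.
move=> vge c /andP[c0 cR].
have vc0 : 0 <= v c by apply: vge; rewrite c0 ltW.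
rewrite lt_neqAle vc0 andbT eq_sym; apply/negP => /eqP vc.
have {}c0 : 0 < c.
  rewrite lt_neqAle c0 andbT; apply/eqP => e.
  have : v c = a by rewrite -e.
  by rewrite vc => h; move: a0; rewrite -h ltxx.
have wc : w c = 0.
  have [||||_ h] := @derive1_at_min R v 0 Rad c.
  - exact: ltW.
  - by move=> t; rewrite in_oo => /andP[t0 _]; have [] := dv t t0.
  - by rewrite in_oo c0.
  - by move=> t; rewrite in_oo vc => /andP[t0 tR]; apply: vge; rewrite !ltW.
  by have [_ h'] := dv c c0; rewrite -h' h.
pose Lam := `|lam| + 4 / alpha.
have vz e : 0 < e -> e < c -> v e = 0.
  move=> e0 ec.
  (* On [[e, c]] this dominates the logarithmic decay rate of [En]: [Lam] bounds the potential and
     [k / e] bounds [k / t]. So [En t * e^(C t)] is nondecreasing, and it vanishes at [c]. *)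
  pose C := 1 + Lam + 2 * k%:R / e.
  pose En t := v t ^+ 2 + w t ^+ 2.
  have h : En e * expR (C * e) <= En c * expR (C * c).
    apply: (derive_ge0_le (fun t => (v t ^+ 2 + w t ^+ 2) * expR (C * t))
      (fun t => (2 * v t * w t + 2 * w t * (- g t - k%:R * w t / t) + C * En t) * expR (C * t))).
    - exact: ltW.
    - move=> x /andP[x1 x2]; have x0 := lt_trans e0 x1.
      have h1 := dv x x0; have h2 := dw x x0.
      apply: has_deriv_eq; first by der.
      rewrite /= /En; move: (v x) (w x) (g x) (expR _) (k%:R / x) => p y d u f.
      by ring.
    - move=> x /andP[x1 x2]; have x0 := lt_le_trans e0 x1.
      have h1 := cv x; have h2 := has_deriv_continuous _ _ _ (dw x x0).
      have h3 : {for x, continuous (fun t => expR (C * t))}.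
        by apply: has_deriv_continuous; der.
      by cont.
    - move=> x /andP[x1 x2]; have x0 := lt_trans e0 x1.
      rewrite mulr_ge0 ?expR_ge0//.
      have hp : `|pot x| <= Lam by apply: potential_norm.
      rewrite /source /En /C; move: (pot x) hp => p hp; move: (v x) (w x) => y u.
      have hk : k%:R / x <= k%:R / e by rewrite ler_wpM2l// lef_pV2 ?posrE// ltW.
      have hk2 : k%:R / x * u ^+ 2 <= k%:R / e * u ^+ 2 by rewrite ler_wpM2r ?exprn_even_ge0.
      have k0 : 0 <= k%:R / e :> R by rewrite divr_ge0// ltW.
      have hk3 : 0 <= k%:R / e * y ^+ 2 by rewrite mulr_ge0 ?exprn_even_ge0.
      have h1 : `|2 * y * u| <= y ^+ 2 + u ^+ 2.
        have := sqr_ge0 (y + u); have := sqr_ge0 (y - u).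
        by move=> s1 s2; rewrite ler_norml; apply/andP; split; nra.
      have h2 : `|(1 - p) * (2 * y * u)| <= (1 + Lam) * (y ^+ 2 + u ^+ 2).
        rewrite normrM; apply: ler_pM => //.
        by apply: (le_trans (ler_normB _ _)); rewrite normr1 lerD2l.
      move: h2; rewrite ler_norml => /andP[h2 _].
      have -> : 2 * y * u + 2 * u * (- (p * y) - k%:R * u / x) +
          (1 + Lam + 2 * k%:R / e) * (y ^+ 2 + u ^+ 2) =
        ((1 - p) * (2 * y * u) + (1 + Lam) * (y ^+ 2 + u ^+ 2)) +
        2 * (k%:R / e * u ^+ 2 - k%:R / x * u ^+ 2) + 2 * (k%:R / e * y ^+ 2) by ring.
      apply: addr_ge0; last by rewrite mulr_ge0.
      apply: addr_ge0; last by rewrite mulr_ge0// subr_ge0.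
      by rewrite -lerBlDr sub0r.
  move: h; rewrite {2}/En vc wc !expr0n/= addr0 mul0r pmulr_lle0 ?expR_gt0// /En => h.
  have : v e ^+ 2 <= 0 by apply: le_trans h; rewrite lerDl exprn_even_ge0.
  by rewrite le_eqVlt ltNge exprn_even_ge0//= orbF sqrf_eq0 => /eqP.
(* The Gronwall constant blows up as [e] tends to [0], so the center is reached by this linear bound
   instead: a zero of [v] at [e <= a / (2 M)] would give [a <= M e <= a / 2]. *)
have [M hM] : exists2 M, 0 < M & forall r, 0 <= r <= Rad -> `|v r - a| <= M * r.
  exists (2 * `|a| * ((`|lam| + 4 / alpha) * expR ((2 * (`|lam| + 4 / alpha) + 1) * Rad) * Rad) + 1).
    rewrite ltr_wpDl// !mulr_ge0 ?expR_ge0 ?addr_ge0 ?divr_ge0// ltW//.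
  move=> r /[dup] rR /andP[r0 _].
  apply: (le_trans (shoot_near_start _ _ _ _ _ (normr_ge0 lam) a lam r (lexx _) rR)).
  by rewrite ler_wpM2r// lerDl.
move=> hva; pose e := Num.min (c / 2) (a / (2 * M)).
have e0 : 0 < e by rewrite lt_min !divr_gt0// mulr_gt0.
have ec : e < c by rewrite gt_min ltr_pdivrMr// ltr_pMr// ltr1n.
have eR : 0 <= e <= Rad by rewrite ltW//= (le_trans (ltW ec))// ltW.
have h1 : a <= M * e by have := hva e eR; rewrite vz// sub0r normrN gtr0_norm.
have h2 : M * e <= a / 2.
  rewrite mulrC -ler_pdivlMr// -mulrA -invfM ge_min.
  by rewrite lexx orbT.
by have := le_trans h1 h2; rewrite leNgt ltr_pdivrMr// ltr_pMr// ltr1n.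
Qed.

End edges.

(** * Choice of the shooting parameters *)

Section primitive_bounds.
Context {R : realType}.
Implicit Types (f : R -> R) (b c C : R).

Lemma primitive_dist f1 f2 (b C : R) : continuous f1 -> continuous f2 -> 0 <= b ->
  (forall t, 0 <= t <= b -> `|f1 t - f2 t| <= C) ->
  `|primitive f1 b - primitive f2 b| <= C * b.
Proof.
move=> c1 c2 b0 h; have /= := derive_norm_le (fun t => primitive f1 t + - primitive f2 t)
  (fun t => C * t) (fun t => f1 t + - f2 t) (fun=> C) 0 b b0.
rewrite !primitive0 mulr0 !(oppr0, addr0); apply.
- move=> x /andP[x0 _]; have h1 := has_deriv_primitive f1 x c1 (N1_lt _ (ltW x0)).
  by have h2 := has_deriv_primitive f2 x c2 (N1_lt _ (ltW x0)); der.
- by move=> x _; apply: has_deriv_eq; [der|rewrite /=; ring].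
- move=> x /andP[x0 _]; have h1 := continuous_primitive f1 x c1 (N1_lt _ x0).
  by have h2 := continuous_primitive f2 x c2 (N1_lt _ x0); cont.
- by move=> x _; cont.
- by move=> x /andP[x0 xb]; apply: h; rewrite !ltW.
Qed.

Lemma primitive_norm_le f b C : continuous f -> 0 <= b ->
  (forall t, 0 <= t <= b -> `|f t| <= C) -> `|primitive f b| <= C * b.
Proof.
move=> cf b0 h; have /= := derive_norm_le (primitive f) (fun t => C * t) f (fun=> C) 0 b b0.
rewrite primitive0 mulr0 !(oppr0, addr0); apply.
- by move=> x /andP[x0 _]; exact: has_deriv_primitive (N1_lt _ (ltW x0)).
- by move=> x _; apply: has_deriv_eq; [der|rewrite /=; ring].
- by move=> x /andP[x0 _]; exact: continuous_primitive (N1_lt _ x0).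
- by move=> x _; cont.
- by move=> x /andP[x0 xb]; apply: h; rewrite !ltW.
Qed.

Lemma primitive_homo f b c : continuous f -> 0 <= b -> b <= c ->
  (forall t, 0 <= t -> 0 <= f t) -> primitive f b <= primitive f c.
Proof.
move=> cf b0 bc h; apply: (derive_ge0_le (primitive f) f) => //.
- move=> x /andP[bx _]; apply: has_deriv_primitive => //.
  by rewrite N1_lt// (le_trans b0)// ltW.
- by move=> x /andP[bx _]; apply: continuous_primitive => //; rewrite N1_lt// (le_trans b0).
- by move=> x /andP[bx _]; apply: h; rewrite (le_trans b0)// ltW.
Qed.

Lemma primitive_ge_monomial f b C j : continuous f -> 0 <= b ->
  (forall t, 0 < t < b -> C * t ^+ j <= f t) ->
  C * b ^+ j.+1 / j.+1%:R <= primitive f b.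
Proof.
move=> cf b0 h.
have /= := derive_ge0_le (fun t => primitive f t + - (C * t ^+ j.+1 * j.+1%:R^-1))
  (fun t => f t + - (C * t ^+ j)) 0 b b0.
rewrite primitive0 expr0n/= mulr0 mul0r !(oppr0, addr0) subr_ge0; apply.
- move=> x /andP[x0 _]; have h1 := has_deriv_primitive f x cf (N1_lt _ (ltW x0)).
  apply: has_deriv_eq; first by der.
  rewrite /=; have : j.+1%:R != 0 :> R by rewrite pnatr_eq0.
  by move: (j.+1%:R : R) => y y0; field.
- move=> x /andP[x0 _]; have h1 := continuous_primitive f x cf (N1_lt _ x0).
  by cont.
- by move=> x /h; rewrite subr_ge0.
Qed.

End primitive_bounds.

Section shooting_parameters.
Context {R : realType}.
Variables (m : nat) (alpha Rad mass : R).
Hypothesis alpha0 : 0 < alpha.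
Hypothesis Rad0 : 0 < Rad.
Hypothesis mass0 : 0 < mass.
Implicit Types (a lam r : R).

Local Notation v := (shoot m alpha alpha0).
Let k := (2 * m).+1.
Let density a lam r := r * (r ^+ m * v a lam r) ^+ 2.
Let lamL : R := - (2 / alpha).
Let lamH : R := 64 / Rad ^+ 2 + 2 * (k%:R / Rad) ^+ 2.
Let Lam := 2 / alpha + lamH.
Let L := Lam + 4 / alpha.
Let B := expR ((2 * L + 1) * Rad).

Let lamH0 : 0 < lamH.
Proof.
apply: ltr_pwDl; first by rewrite divr_gt0// exprn_gt0.
by rewrite mulr_ge0// exprn_even_ge0.
Qed.
Let ia : 0 < 2 / alpha. Proof. by rewrite divr_gt0. Qed.
Let Lam0 : 0 <= Lam. Proof. by rewrite addr_ge0// ltW. Qed.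
Let L0 : 0 <= L. Proof. by rewrite addr_ge0// divr_ge0// ltW. Qed.
Let B0 : 0 < B. Proof. exact: expR_gt0. Qed.

Let lam_bound lam : lamL <= lam <= lamH -> `|lam| <= Lam.
Proof.
move=> /andP[h1 h2]; rewrite ler_norml; apply/andP; split.
  by apply: le_trans h1; rewrite lerN2 lerDl ltW.
by apply: (le_trans h2); rewrite lerDr ltW.
Qed.

Let cdensity a lam : continuous (density a lam).
Proof.
by move=> x; have h := continuous_shoot m alpha alpha0 a lam x; rewrite /density; cont.
Qed.

Let density_ge0 a lam r : 0 <= r -> 0 <= density a lam r.
Proof. by move=> r0; rewrite mulr_ge0// exprn_even_ge0. Qed.

Let densityE a lam r : density a lam r = r ^+ k * v a lam r ^+ 2.
Proof. by rewrite /density /k exprMn -exprM mulnC mulrA -exprS. Qed.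

Let rk_le r : 0 <= r <= Rad -> 0 <= r ^+ k <= Rad ^+ k.
Proof.
by move=> /andP[r0 rR]; rewrite exprn_ge0//= lerXn2r// nnegrE ltW.
Qed.

Let v_le a lam r : 0 <= a -> lamL <= lam <= lamH -> 0 <= r <= Rad ->
  `|v a lam r| <= 2 * a * B.
Proof.
move=> a0 /lam_bound hl rR; rewrite -{2}(ger0_norm a0).
exact: (shoot_le m alpha alpha0 Lam Rad Lam0 a lam r hl rR).
Qed.

Lemma shooting_parameters : exists a lam, [/\ 0 < a,
  forall r, 0 <= r < Rad -> 0 < v a lam r, v a lam Rad = 0 &
  primitive (fun r => r * (r ^+ m * v a lam r) ^+ 2) Rad = mass].
Proof.
(* The mass of the solution started at height [a] is at most [a^2 q], from [|v| <= 2 a B]. The cap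
   [1] in [a0] turns [a0^2 q] into at most [a0 q <= mass]. *)
pose q := 4 * B ^+ 2 * Rad ^+ k * Rad.
have q0 : 0 < q by rewrite !mulr_gt0// exprn_gt0.
pose a0 := Num.min 1 (mass / q).
have a0_gt0 : 0 < a0 by rewrite lt_min ltr01 divr_gt0.
(* On [[0, d]] [shoot_near_start] gives [v >= a / 2], so the mass is at least [a^2 q1]. The choice
   of [a1 >= 1] below then ensures [a1^2 q1 >= a1 q1 > mass]. *)
pose d := Num.min Rad (4 * (L * B * Rad + 1))^-1.
have LBR : 0 <= L * B * Rad by rewrite !mulr_ge0// ltW.
have d0 : 0 < d by rewrite lt_min Rad0 invr_gt0 mulr_gt0// ltr_wpDl.
have dR : d <= Rad by rewrite ge_min lexx.
pose q1 := 4^-1 * d ^+ k.+1 / k.+1%:R.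
have q10 : 0 < q1 by rewrite divr_gt0// mulr_gt0// exprn_gt0.
pose a1 := a0 + 1 + mass / q1.
have a01 : a0 < a1 by rewrite /a1 -addrA ltrDl addr_gt0// divr_gt0.
have a1_gt1 : 1 <= a1.
  by rewrite /a1 -addrA addrCA lerDl ltW// addr_gt0// divr_gt0.
have a1_gt0 : 0 < a1 by rewrite (lt_le_trans ltr01).
have apos a : a0 <= a <= a1 -> 0 < a by move=> /andP[h _]; exact: lt_le_trans h.
have lamLH : lamL < lamH by rewrite (lt_trans _ lamH0)// oppr_lt0.
have hmin (p : R * R) : exists c, 0 <= c <= Rad /\
    forall t, 0 <= t <= Rad -> v p.2 p.1 c <= v p.2 p.1 t.
  have [c h1 h2] := min_attained (v p.2 p.1) 0 Rad (ltW Rad0)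
    (fun x _ => continuous_shoot m alpha alpha0 p.2 p.1 x).
  by exists c.
have [cm hcm] := choice hmin.
pose F lam a := v a lam (cm (lam, a)).
pose G lam a := primitive (density a lam) Rad - mass.
(* [K1] is a Lipschitz constant of [v] in the parameters, from [shoot_lip] with [a' <= a1]. In [K2]
   the factor [4 a1 B] bounds the sum of two values of [v] when a difference of squares is
   factored. *)
pose K1 := 2 * B * (1 + 2 * a1 * B).
have K10 : 0 < K1 by rewrite !mulr_gt0// ltr_pwDl// !mulr_ge0// ltW.
pose K2 := Rad ^+ k * (4 * a1 * B * K1) * Rad.
have K20 : 0 < K2.
  by apply: mulr_gt0 => //; apply: mulr_gt0; [exact: exprn_gt0|rewrite mulr_gt0// !mulr_gt0].
have vlip lam a lam' a' r : lamL <= lam <= lamH -> lamL <= lam' <= lamH ->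
    a0 <= a <= a1 -> a0 <= a' <= a1 -> 0 <= r <= Rad ->
    `|v a lam r - v a' lam' r| <= K1 * (`|lam - lam'| + `|a - a'|).
  move=> hl hl' ha ha' hr.
  apply: (le_trans (shoot_lip m alpha alpha0 Lam Rad Lam0 a lam a' lam' r
    (lam_bound _ hl) (lam_bound _ hl') hr)); rewrite -/L -/B.
  have -> : K1 * (`|lam - lam'| + `|a - a'|) = 2 * ((1 + 2 * a1 * B) * `|a - a'| +
      `|lam - lam'| * (1 + 2 * a1 * B)) * B by rewrite /K1; ring.
  rewrite ler_pM2r// ler_pM2l//; apply: lerD.
    by rewrite ler_peMl// lerDl !mulr_ge0// ltW.
  rewrite ler_wpM2l// (gtr0_norm (apos _ ha')); apply: (@le_trans _ _ (2 * a1 * B)).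
    by rewrite ler_pM2r// ler_pM2l//; case/andP: ha'.
  by rewrite lerDr.
(* The chosen minimum point [cm] may jump with the parameters, but the minimum does not: each
   function is evaluated at the minimum point of the other. *)
have FL : lipschitz_rect lamL lamH a0 a1 (K1 + K2) F.
  move=> lam a lam' a' hl hl' ha ha'.
  have [h1 h2] := hcm (lam, a); have [h1' h2'] := hcm (lam', a').
  apply: (@le_trans _ _ (K1 * (`|lam - lam'| + `|a - a'|))); last first.
    by rewrite ler_wpM2r ?addr_ge0// lerDl ltW.
  rewrite ler_norml; apply/andP; split.
    have := vlip _ _ _ _ _ hl hl' ha ha' h1; rewrite ler_norml => /andP[h3 _].
    apply: (le_trans h3); rewrite lerD2l lerN2; exact: h2'.
  have := vlip _ _ _ _ _ hl hl' ha ha' h1'; rewrite ler_norml => /andP[_ h3].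
  apply: le_trans h3; rewrite lerD2r; exact: h2.
have GL : lipschitz_rect lamL lamH a0 a1 (K1 + K2) G.
  move=> lam a lam' a' hl hl' ha ha'.
  apply: (@le_trans _ _ (K2 * (`|lam - lam'| + `|a - a'|))); last first.
    by rewrite ler_wpM2r ?addr_ge0// lerDr ltW.
  rewrite /G opprB addrA subrK.
  rewrite (_ : K2 * _ = Rad ^+ k * (K1 * (`|lam - lam'| + `|a - a'|) * (4 * a1 * B)) * Rad); last first.
    by rewrite /K2; ring.
  apply: primitive_dist => //; first exact: ltW.
  move=> t tR; rewrite !densityE -mulrBr normrM subr_sqr.
  have /andP[tk0 tk] := rk_le t tR.
  rewrite (ger0_norm tk0); apply: ler_pM => //; rewrite normrM; apply: ler_pM => //.
    exact: vlip.
  apply: (le_trans (ler_normD _ _)).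
  have h1 := v_le a lam t (ltW (apos _ ha)) hl tR.
  have h2 := v_le a' lam' t (ltW (apos _ ha')) hl' tR.
  rewrite (_ : 4 * a1 * B = 2 * a1 * B + 2 * a1 * B); last by ring.
  apply: lerD; [apply: (le_trans h1)|apply: (le_trans h2)].
    by rewrite ler_pM2r// ler_pM2l//; case/andP: ha.
  by rewrite ler_pM2r// ler_pM2l//; case/andP: ha'.
have Fleft a : a0 <= a <= a1 -> 0 < F lamL a.
  move=> ha; have [/andP[c0 _] _] := hcm (lamL, a).
  by apply: shoot_pos_of_low => //; exact: apos.
have Fright a : a0 <= a <= a1 -> F lamH a <= 0.
  move=> ha; have [_ h] := hcm (lamH, a).
  have [r rR hr] := shoot_not_pos_of_high m alpha Rad a lamH alpha0 Rad0 (lexx _).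
  exact: le_trans (h r rR) hr.
have Gbot lam : lamL <= lam <= lamH -> G lam a0 <= 0.
  move=> hl; rewrite subr_le0.
  have h : forall t, 0 <= t <= Rad -> `|density a0 lam t| <= Rad ^+ k * (2 * a0 * B) ^+ 2.
    move=> t tR; have /andP[tk0 tk] := rk_le t tR.
    rewrite densityE normrM (ger0_norm tk0) normrX; apply: ler_pM => //.
    rewrite lerXn2r ?nnegrE// ?mulr_ge0 ?(ltW a0_gt0) ?(ltW B0)//.
    by apply: v_le => //; exact: ltW.
  have := primitive_norm_le (density a0 lam) Rad _ (cdensity a0 lam) (ltW Rad0) h.
  move=> /(le_trans (ler_norm _)) /le_trans; apply.
  rewrite [leLHS](_ : _ = a0 * (a0 * q)); last by rewrite /q; ring.
  apply: (@le_trans _ _ (1 * (mass / q * q))); last by rewrite mul1r divfK// gt_eqF.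
  have h1 : a0 <= 1 by rewrite /a0 ge_min lexx.
  have h2 : a0 * q <= mass / q * q by rewrite ler_pM2r// /a0 ge_min lexx orbT.
  by apply: ler_pM => //; apply/ltW => //; exact: mulr_gt0.
have Gtop lam : lamL <= lam <= lamH -> 0 < G lam a1.
  move=> hl; rewrite subr_gt0.
  apply: (@lt_le_trans _ _ (a1 ^+ 2 * q1)).
    apply: (@lt_le_trans _ _ (a1 * q1)).
      by rewrite -ltr_pdivrMr// /a1 ltrDr addr_gt0.
    by rewrite ler_pM2r// expr2 ler_peMr// ltW.
  apply: (@le_trans _ _ (primitive (density a1 lam) d)); last first.
    by apply: (primitive_homo _ _ _ (cdensity _ _) (ltW d0) dR) => t; exact: density_ge0.
  rewrite (_ : a1 ^+ 2 * q1 = a1 ^+ 2 / 4 * d ^+ k.+1 / k.+1%:R); last by rewrite /q1; ring.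
  apply: (primitive_ge_monomial _ _ _ _ (cdensity _ _) (ltW d0)).
  move=> t /andP[t0 td]; rewrite densityE mulrC ler_pM2l ?exprn_gt0//.
  have tR : 0 <= t <= Rad by rewrite ltW//= (le_trans (ltW td)).
  have := shoot_near_start m alpha alpha0 Lam Rad Lam0 a1 lam t (lam_bound _ hl) tR.
  rewrite -/L -/B (gtr0_norm a1_gt0) => h.
  have h2 : 2 * a1 * (L * B * Rad) * t <= a1 / 2.
    have h3 : t * (4 * (L * B * Rad + 1)) <= 1.
      rewrite -ler_pdivlMr ?mulr_gt0 ?ltr_wpDl// div1r (le_trans (ltW td))//.
      by rewrite ge_min lexx orbT.
    have -> : 2 * a1 * (L * B * Rad) * t = a1 / 2 * (t * (4 * (L * B * Rad))) by field.
    rewrite ler_piMr ?divr_ge0 ?(ltW a1_gt0)//; apply: le_trans h3.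
    by rewrite ler_pM2l// ler_pM2l// lerDl.
  have h4 : a1 / 2 <= v a1 lam t.
    move: h; rewrite ler_distlC => /andP[_ h]; move: h h2.
    by move: (_ * t) (v a1 lam t) => x y; lra.
  rewrite (_ : a1 ^+ 2 / 4 = (a1 / 2) ^+ 2); last by field.
  by rewrite lerXn2r// nnegrE ?divr_ge0 ?(ltW a1_gt0)// (le_trans _ h4)// divr_ge0// ltW.
have [lam [a [hl ha F0 G0]]] := poincare_miranda lamL lamH a0 a1 (K1 + K2) F G
  lamLH a01 (addr_gt0 K10 K20) FL GL Fleft Fright Gbot Gtop.
have [cR hc] := hcm (lam, a).
have vge r : 0 <= r <= Rad -> 0 <= v a lam r by move=> /hc; rewrite /= -/(F lam a) F0.
have vpos := shoot_touching m alpha Rad a lam alpha0 Rad0 (apos _ ha) vge.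
exists a, lam; split=> //; first exact: apos.
  have [c0 cRad] := andP cR.
  have : ~~ (cm (lam, a) < Rad).
    apply/negP => cl; have := vpos (cm (lam, a)).
    by rewrite c0 cl -/(F lam a) F0 ltxx => /(_ isT).
  rewrite -leNgt => h; suff <- : cm (lam, a) = Rad by [].
  by apply/eqP; rewrite eq_le cRad.
by apply/eqP; rewrite -subr_eq0; apply/eqP.
Qed.

End shooting_parameters.

(** * Back to the vortex equation *)

Section existence.
Context {R : realType}.
Variables (m' : nat) (alpha Rad Q0 : R).
Hypotheses (alpha0 : 0 < alpha) (Rad0 : 0 < Rad) (Q00 : 0 < Q0).
Implicit Types r s t x : R.
Let m := m'.+1.

Lemma integral_continuous_lty (f : R -> R) : continuous f ->
  (\int[lebesgue_measure]_(r in `]0%R, Rad[) (f r)%:E < +oo)%E.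
Proof.
move=> cf; have h : lebesgue_measure.-integrable `[0, Rad] (EFin \o f).
  apply: continuous_compact_integrable; first exact: segment_compact.
  by apply: continuous_within => y _; exact: cf.
have h' : lebesgue_measure.-integrable `]0, Rad[ (EFin \o f).
  by apply: integrableS h => //; exact: subset_itv_oo_cc.
by have := integrable_lty _ h'; exact.
Qed.

Lemma positive_solution : exists (u : R -> R) (kappa : R),
  [/\ {within `[0%R, Rad], continuous u},
   (forall r, 0 < r < Rad -> derivable u r 1 /\ derivable (derive1 u) r 1 /\
     derive1 (fun s : R => s * derive1 u s) r - m%:R ^+ 2 / r * u r
       + 2 * r * (u r) ^+ 3 / (1 + alpha * (u r) ^+ 2) - 2 * kappa * r * u r = 0),
   u 0 = 0 /\ u Rad = 0 & [/\ flux Rad u = Q0%:E, (energy alpha Rad u < +oo)%E &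
   forall r, 0 < r < Rad -> 0 < u r]].
Proof.
have mass0 : 0 < Q0 / (2 * pi) by rewrite divr_gt0// mulr_gt0// pi_gt0.
have [a [lam [a0 vpos vR vmass]]] := shooting_parameters m alpha Rad _ alpha0 Rad0 mass0.
pose v := shoot m alpha alpha0 a lam; pose w := dshoot m alpha alpha0 a lam.
pose g := source m alpha lam v.
have cv r : {for r, continuous v} by exact: continuous_shoot.
pose u r := r ^+ m * v r.
pose du r := m%:R * r ^+ m' * v r + r ^+ m * w r.
have dv r : 0 < r -> has_deriv v r (w r) by exact: shoot_deriv.
have dw r : 0 < r -> has_deriv w r (- g r - (2 * m).+1%:R * w r / r) by exact: dshoot_deriv.
have hu r : 0 < r -> has_deriv u r (du r).
  move=> r0; have h := dv r r0.
  by apply: (has_deriv_eq (fun t => t ^+ m * v t)); [der|rewrite /du /=; ring].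
have derive_u r : 0 < r -> derive1 u r = du r by move=> r0; rewrite derive1E; have [_ ->] := hu r r0.
have near_du (r : R) : 0 < r -> \forall s \near r, derive1 u s = du s.
  by move=> r0; near=> s; apply: derive_u; near: s; exact: lt_nbhsr.
(* The terms in [w] cancel: [m + (m + 1)] from the product rule against the damping coefficient
   [2m + 1]. *)
have hsdu r : 0 < r -> has_deriv (fun s => s * du s) r
    (m%:R ^+ 2 * r ^+ m' * v r - r ^+ m.+1 * g r).
  move=> r0; have h1 := dv r r0; have h2 := dw r r0.
  rewrite (_ : (fun s => s * du s) = (fun s => m%:R * s ^+ m * v s + s ^+ m.+1 * w s)); last first.
    by apply/funext => s; rewrite /du !exprS; ring.
  apply: has_deriv_eq; first by der.
  have -> : (2 * m).+1%:R = 2 * m%:R + 1 :> R by rewrite -natr1 natrM.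
  have -> : m.+1%:R = m%:R + 1 :> R by rewrite natr1.
  rewrite (_ : m.+1.-1 = m)// (_ : m.-1 = m')// !exprS.
  move: (m%:R : R) (v r) (w r) (g r) => M x y z; field.
  by rewrite gt_eqF.
have hdu r : 0 < r -> derivable du r 1.
  move=> r0; have h1 := dv r r0; have h2 := dw r r0.
  have [d [hd _]] : exists d, has_deriv du r d by eexists; rewrite /du; der.
  exact: hd.
exists u, (- lam / 2); split.
- by apply: continuous_within => x _; have h := cv x; rewrite /u; cont.
- move=> r /andP[r0 rR]; split; first by case: (hu r r0).
  split.
    apply: (@near_eq_derivable _ _ _ du); last exact: hdu.
    by near=> s; apply/esym; near: s; exact: near_du.
  have -> : derive1 (fun s : R => s * derive1 u s) r = m%:R ^+ 2 * r ^+ m' * v r - r ^+ m.+1 * g r.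
    have h : has_deriv (fun s : R => s * derive1 u s) r (m%:R ^+ 2 * r ^+ m' * v r - r ^+ m.+1 * g r).
      apply: near_has_deriv (hsdu r r0); near=> s; congr (_ * _).
      by apply/esym; near: s; exact: near_du.
    by rewrite derive1E; have [_ ->] := h.
  have den : 0 < 1 + alpha * (r ^+ m * v r) ^+ 2 by apply: one_add_sq_gt0; exact: ltW.
  rewrite /g /source /potential /u; move: (v r) den => x; rewrite /m (exprS r m'.+1) !(exprS r m') => den.
  by field; rewrite (gt_eqF r0) andbT; exact: lt0r_neq0 den.
- by rewrite /u -[v Rad]/(shoot m alpha alpha0 a lam Rad) vR mulr0 expr0n mul0r.
split.
- rewrite /flux integral_primitive//; last by move=> x; have h := cv x; rewrite /u; cont.
  rewrite -[primitive _ _]/(primitive (fun r => r * (r ^+ m * v r) ^+ 2) Rad) vmass.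
  by rewrite -EFinM mulrC divfK// gt_eqF// mulr_gt0// pi_gt0.
(* The energy integrand is replaced by a function continuous on the whole line: [W] extends [w]
   continuously through [0], and [u^2 / r] becomes [r^(2m-1) v^2], which is where [m >= 1]
   enters. *)
- pose W r := - average (2 * m) g `|r|.
  have cW r : {for r, continuous W}.
    have h := continuous_average (2 * m) g (continuous_source m alpha alpha0 lam v (continuous_shoot m alpha alpha0 a lam)) r.
    by rewrite /W; cont.
  pose DU r := m%:R * r ^+ m' * v r + r ^+ m * W r.
  pose e r := (r * DU r ^+ 2 + r ^+ m' * r ^+ m * v r ^+ 2 + r * ln (1 + alpha * u r ^+ 2)) / 2.
  have ce : continuous e.
    move=> r; have h1 := cv r; have h2 := cW r; rewrite /e /DU /u; cont.
    by apply: one_add_sq_gt0; exact: ltW.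
  have -> : energy alpha Rad u = (\int[lebesgue_measure]_(r in `]0%R, Rad[) (e r)%:E)%E; last first.
    exact: integral_continuous_lty.
  apply: eq_integral => r; rewrite inE /= in_itv/= => /andP[r0 rR]; congr (_%:E); congr (_ / 2).
  congr (_ + _ + _).
    by rewrite derive_u// /DU /du /W gtr0_norm.
  by rewrite /u /m !(exprS r m'); field; rewrite gt_eqF.
- move=> r /andP[r0 rR]; rewrite /u mulr_gt0 ?exprn_gt0//.
  by apply: vpos; rewrite ltW.
Unshelve. all: by end_near. Qed.

End existence.

(** * Extension of a solution to the line and nonexistence for small flux *)

Section nonexistence_main.
Context {R : realType}.
Variables (n : int) (alpha Rad kappa : R) (u : R -> R).
Hypotheses (alpha0 : 0 < alpha) (Rad0 : 0 < Rad).
Hypothesis cpos : forall r : R, 0 <= r <= Rad -> 0 < (n%:~R) ^+ 2 + 2 * r ^+ 2 * kappa.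

Implicit Types r s t x b : R.

(** The projection of the line onto [[0, b]] for [b >= 0], written with absolute values so that
    [cont] proves its continuity. *)
Definition clamp (b x : R) := (`|x| - `|x - b| + b) / 2.

Lemma clamp_id b x : 0 <= x <= b -> clamp b x = x.
Proof.
move=> /andP[x0 xb]; rewrite /clamp (ger0_norm x0) ler0_norm ?subr_le0//; lra.
Qed.

Lemma clamp_in b x : 0 <= b -> 0 <= clamp b x <= b.
Proof.
move=> b0; rewrite /clamp; have := ler_distD x 0 b; have := ler_distD 0 x b.
rewrite !sub0r !subr0 normrN (ger0_norm b0) => h1 h2.
have h3 : `|x| <= `|x - b| + b.
  by have := ler_normD (x - b) b; rewrite subrK (ger0_norm b0).
by apply/andP; split; rewrite ?divr_ge0// ?ler_pdivrMr//; lra.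
Qed.

Lemma continuous_clamp (b : R) : continuous (clamp b).
Proof. by move=> x; rewrite /clamp; cont. Qed.

Lemma continuous_clamped (f : R -> R) (b : R) : 0 <= b ->
  {within `[0, b], continuous f} -> continuous (fun x => f (clamp b x)).
Proof.
move=> b0 /subspace_continuousP cf x.
have inb y : (`[0, b]%classic : set R) (clamp b y) by rewrite /= in_cc; exact: clamp_in.
have := cf _ (inb x); move=> h.
apply: (cvg_comp (clamp b) f _ h) => P.
rewrite /within/= => hP.
have := @continuous_clamp b x _ hP => hQ.
by near=> y; have : (`[0, b]%classic : set R) (clamp b y) by []; near: y; exact: hQ.
Unshelve. all: by end_near. Qed.

Lemma small_flux_trivial (Q0 : R) : vortex_solution n alpha Rad kappa u ->
  flux Rad u = Q0%:E -> Q0 <= 1 / 4 -> forall r, 0 <= r <= Rad -> u r = 0.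
Proof.
move=> [cu [hu [u0 uR]]] hQ Q4.
(* A solution is arbitrary outside [[0, Rad]], whereas [primitive] is differentiated only for
   integrands continuous on the whole line; [U] is the extension of [u] by its end values. *)
pose U x := u (clamp Rad x).
have cU : continuous U by apply: continuous_clamped => //; exact: ltW.
have UE x : 0 <= x <= Rad -> U x = u x by move=> h; rewrite /U clamp_id.
have dU r : 0 < r < Rad -> has_deriv U r (derive1 u r).
  move=> rR; have [du _] := hu r rR; apply: near_has_deriv; last first.
    by split; [exact: du|rewrite derive1E].
  near=> s; rewrite UE//; apply/andP; split; apply/ltW; near: s.
    by apply: lt_nbhsr; case/andP: rR.
  by apply: lt_nbhsl; case/andP: rR.
have eqn r : 0 < r < Rad -> has_deriv (fun s : R => s * derive1 u s) r
    ((n%:~R) ^+ 2 / r * U r - 2 * r * U r ^+ 3 / (1 + alpha * U r ^+ 2) + 2 * kappa * r * U r).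
  move=> /[dup] rR /andP[r0 r1]; have [_ [ddu e]] := hu r rR.
  have h : derivable (fun s : R => s * derive1 u s) r 1.
    by apply: derivableM => //; exact: derivable_id.
  split; first exact: h.
  rewrite -derive1E UE ?ltW//; move: e.
  set A := derive1 _ r; set P := _ / r * u r; set Q := _ / (1 + _); set S := 2 * kappa * r * u r.
  by move: A P Q S => A P Q S E; lra.
have cm : continuous (fun r => r * U r ^+ 2) by move=> x; have h := cU x; cont.
have hm : primitive (fun r => r * U r ^+ 2) Rad <= 1 / 16.
  move: hQ; rewrite /flux.
  have -> : (\int[lebesgue_measure]_(r in `[0%R, Rad]) (r * u r ^+ 2)%:E =
      \int[lebesgue_measure]_(r in `[0%R, Rad]) (r * U r ^+ 2)%:E)%E.
    by apply: eq_integral => r; rewrite inE /= in_cc => rR; rewrite UE.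
  rewrite integral_primitive// -EFinM => -[] h.
  have pi2 := @pi_ge2 R.
  have : 2 * pi * primitive (fun r => r * U r ^+ 2) Rad <= 1 / 4 by rewrite h.
  move: (primitive _ _) => M hM; rewrite leNgt; apply/negP => M1.
  have : 2 * 2 * M <= 2 * pi * M.
    by rewrite ler_wpM2r ?ler_pM2l// ltW// (lt_trans _ M1)// divr_gt0.
  by move=> h2; have := le_trans h2 hM; lra.
have c0 r : 0 < r < Rad -> 0 < (n%:~R) ^+ 2 + 2 * r ^+ 2 * kappa.
  by move=> /andP[r0 r1]; apply: cpos; rewrite !ltW.
have R0 : 0 <= (0 : R) <= Rad by rewrite lexx ltW.
have RR : 0 <= Rad <= Rad by rewrite lexx ltW.
have := small_mass_trivial U (derive1 u) alpha Rad kappa _ alpha0 cU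
  (etrans (UE _ R0) u0) (etrans (UE _ RR) uR) dU eqn c0 hm.
move=> h r rR; case/andP: (rR); rewrite le_eqVlt => /orP[/eqP<-//|r0].
rewrite le_eqVlt => /orP[/eqP->//|r1].
by rewrite -UE// h// r0.
Unshelve. all: by end_near. Qed.

End nonexistence_main.

Theorem theorem3p1 (R : realType) (n : int) (alpha Rad Q0 : R)
  (hn : (1 <= `|n|)%R) (halpha : 0 < alpha) (hRad : 0 < Rad) (hQ0 : 0 < Q0) :
  (exists (u : R -> R) (kappa : R),
     vortex_solution n alpha Rad kappa u /\
     flux Rad u = Q0%:E /\
     (energy alpha Rad u < +oo)%E /\
     (forall r, 0 < r < Rad -> 0 < u r))
  /\
  (forall kappa : R,
     (forall r, 0 <= r <= Rad -> 0 < (n%:~R) ^+ 2 + 2 * r ^+ 2 * kappa) ->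
     Q0 <= 1 / 4 ->
     ~ (exists u : R -> R,
          vortex_solution n alpha Rad kappa u /\
          (energy alpha Rad u < +oo)%E /\
          flux Rad u = Q0%:E /\
          (exists r, 0 <= r <= Rad /\ u r != 0))).
Proof.
split; last first.
  move=> kappa hk hQ [u [hu [_ [hf [r [rR /eqP]]]]]]; apply.
  exact: (small_flux_trivial n alpha Rad kappa u halpha hRad hk Q0 hu hf hQ r rR).
have [m' hm] : exists m', `|n|%N = m'.+1.
  by exists `|n|%N.-1; rewrite prednK// absz_gt0; apply: contraTneq hn => ->.
have nm : (n%:~R : R) ^+ 2 = m'.+1%:R ^+ 2.
  by rewrite -hm natr_absz intr_norm real_normK// num_real.
have [u [kappa [h1 h2 [h3 h4] [h5 h6 h7]]]] := positive_solution m' alpha Rad Q0 halpha hRad hQ0.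
exists u, kappa; split=> //; split=> //; split=> //.
by rewrite nm.
Qed.
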